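(* Suppose Problem (P), with terminal covariance $\Sigma_f$ given by the semidefinite program (SDP) and terminal set $\mathcal{X}_f^\mu$ given by (T), is feasible at time $k=0$. Then the control policy $u_k=u^*_{k|k}$ generated by solving Problem (P) at each time step using the initialization (I) ensures that the system $x_{k+1}=A_kx_k+B_ku_k+D_kw_k+r_k$ satisfies $$\Pr(\alpha_{x,i}^\top x_k\le\beta_{x,i}\mid x_0)\ge1-p_{x,i},\qquad \Pr(\alpha_{u,j}^\top u_k\le\beta_{u,j}\mid x_0)\ge1-p_{u,j},$$ for $i=1,\dots,N_x$, $j=1,\dots,N_u$ and $k=0,1,2,\dots$.
   Context: System: $x_{k+1}=A_kx_k+B_ku_k+D_kw_k+r_k$, with fully observed state $x_k\in\mathbb{R}^{n_x}$, control $u_k\in\mathbb{R}^{n_u}$, i.i.d. $w_k\sim\mathcal{N}(0,I_{n_w})$ ($w_k$ independent of the past), and $[A_k\ B_k\ D_k\ r_k]\in\mathcal{S}=\mathrm{co}\{S^1,\dots,S^{N_p}\}$ (convex hull), $S^\ell=[A^\ell\ B^\ell\ D^\ell\ r^\ell]$. Constraint data: $\alpha_{x,i},\alpha_{u,j},\beta_{x,i},\beta_{u,j}$, probabilities $p_{x,i},p_{u,j}$; $\mathcal{X}=\bigcap_i\{x:\alpha_{x,i}^\top x\le\beta_{x,i}\}$. Stage cost: $\ell_k(x,u)=(x-x_{g_k})^\top Q_k(x-x_{g_k})+u^\top R_ku$, known bounded $Q_k\succeq0$, $R_k\succ0$, known $x_{g_k}\in\mathcal{X}$. Problem (P) at time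 $k$, with horizon $N$ and data $(\mu_k,\Sigma_k)$: minimize over sequences of state-feedback policies $\{\rho_{k|k}(\cdot),\dots,\rho_{k+N-1|k}(\cdot)\}$ the cost $\sum_{t=k}^{k+N-1}\mathbb{E}[\ell_t(x_{t|k},u_{t|k})]$ subject to, for $t=k,\dots,k+N-1$: $x_{t+1|k}=A_tx_{t|k}+B_tu_{t|k}+D_tw_t+r_t$; $x_{k|k}\sim\mathcal{N}(\mu_k,\Sigma_k)$; $u_{t|k}=\rho_{t|k}(x_{t|k})$; $\Pr(\alpha_{x,i}^\top x_{t|k}\le\beta_{x,i})\ge1-p_{x,i}$ for all $i$; $\Pr(\alpha_{u,j}^\top u_{t|k}\le\beta_{u,j})\ge1-p_{u,j}$ for all $j$; and terminal constraints $\mathbb{E}[x_{k+N|k}]\in\mathcal{X}_f^\mu$, $\mathrm{Cov}(x_{k+N|k})\preceq\Sigma_f$. When (P) is feasible at time $k$, $\{\rho^*_{t|k}\}$ denotes an optimal solution (taken to exist). Convention: all policies considered are such that predicted states are Gaussian, $x^*_{t|k}\sim\mathcal{N}(\mu^*_{t|k},\Sigma^*_{t|k})$. The applied control is $u_k=u^*_{k|k}=\rho^*_{k|k}(x_k)$. Initialization (I): $(\mu_0,\Sigma_0)=(x_0,0)$; for $k>0$, $(\mu_k,\Sigma_k)=(\mu^*_{k|k-1},\Sigma^*_{k|k-1})$, where $\mu^*_{k+1|k}=A_k\mu_k+B_k\bar u_k+r_k$ and $\Sigma^*_{k+1|k}=A_k\Sigma_kA_k^\top+A_k\Sigma_{xu_k}B_k^\top+B_k\Sigma_{xu_k}^\top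 A_k^\top+B_k\Sigma_{u_k}B_k^\top+D_kD_k^\top$, with, for $x_k\sim\mathcal{N}(\mu_k,\Sigma_k)$ and $u_k=\rho^*_{k|k}(x_k)$: $\bar u_k=\mathbb{E}[u_k]$, $\Sigma_{xu_k}=\mathbb{E}[(x_k-\mu_k)(u_k-\bar u_k)^\top]$, $\Sigma_{u_k}=\mathbb{E}[(u_k-\bar u_k)(u_k-\bar u_k)^\top]$. (SDP): $\Sigma_f=\tilde\Sigma^*$, where $(\tilde\Sigma^*,Z^* )$ minimizes $\mathrm{tr}(\tilde\Sigma)$ over $\tilde\Sigma\in\mathbb{R}^{n_x\times n_x}$, $Z\in\mathbb{R}^{n_u\times n_x}$ subject to $\begin{bmatrix}\tilde\Sigma-D^\ell D^{\ell\top}&A^\ell\tilde\Sigma+B^\ell Z\\ \tilde\Sigma A^{\ell\top}+Z^\top B^{\ell\top}&\tilde\Sigma\end{bmatrix}\succeq0$ for $\ell=1,\dots,N_p$; $\tilde L^*=Z^*(\tilde\Sigma^* )^{-1}$ (with $\tilde\Sigma^*\succ0$). (T): $\mathcal{X}_f^\mu$ is the largest subset of $\mathcal{X}_{\mathrm{safe}}$ such that for every $\mu\in\mathcal{X}_f^\mu$ there is $v\in\mathcal{U}_{\mathrm{safe}}$ with $A^\ell\mu+B^\ell v+r^\ell\in\mathcal{X}_f^\mu$ for all $\ell=1,\dots,N_p$. Here $\mathcal{X}_{\mathrm{safe}}=\bigcap_i\{\mu:\alpha_{x,i}^\top\mu\le\beta_{x,i}-\sqrt{\alpha_{x,i}^\top\Sigma_f\alpha_{x,i}}\,\Phi^{-1}(1-p_{x,i})\}$,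 $\mathcal{U}_{\mathrm{safe}}=\bigcap_j\{v:\alpha_{u,j}^\top v\le\beta_{u,j}-\sqrt{\alpha_{u,j}^\top\tilde L^*\Sigma_f\tilde L^{*\top}\alpha_{u,j}}\,\Phi^{-1}(1-p_{u,j})\}$, and $\Phi^{-1}$ is the inverse standard normal cumulative distribution function.
   Formalization: The probabilities p_{x,i} and p_{u,j} are assumed to lie in (0, 1/2], so that Φ^{-1}(1-p) is defined and nonnegative; for p > 1/2 the claim fails, since the tightened constraints at Σ_f need not imply the chance constraints at smaller covariance. *)

(* Defs.v *)
From HB Require Import structures.
From mathcomp Require Export all_boot all_order all_algebra.
From mathcomp Require Export all_classical all_reals all_analysis.
Export Order.TTheory GRing.Theory Num.Theory.
Export numFieldNormedType.Exports.

Set Implicit Arguments.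
Unset Strict Implicit.
Unset Printing Implicit Defensive.

Local Open Scope classical_set_scope.
Local Open Scope ring_scope.

(** Matrices carry the sigma-algebra generated by the entries (as [n.-tuple]
    does in the library); on ['cV[R]_n] it is the Borel sigma-algebra of R^n. *)
Section matrix_measurable.
Context (R : realType) (m n : nat).

Definition mx_cylinder : set (set 'M[R]_(m, n)) :=
  \bigcup_(ij in [set: 'I_m * 'I_n])
    preimage_set_system setT (fun M : 'M[R]_(m, n) => M ij.1 ij.2) measurable.

HB.instance Definition _ := @isMeasurable.Build (sigma_display mx_cylinder)
  'M[R]_(m, n) <<s mx_cylinder >>
  (@sigma_algebra0 _ setT mx_cylinder) (@sigma_algebraC 'M[R]_(m, n) mx_cylinder)
  (@sigma_algebra_bigcup _ setT mx_cylinder).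

End matrix_measurable.

Section linear_algebra.
Context {R : realType}.

Definition dotv n (a v : 'cV[R]_n) : R := (a^T *m v) 0 0.

Definition quadf n (M : 'M[R]_n) (v : 'cV[R]_n) : R := (v^T *m M *m v) 0 0.

Definition psd n (M : 'M[R]_n) : Prop :=
  M^T = M /\ forall v : 'cV[R]_n, 0 <= quadf M v.

Definition pd n (M : 'M[R]_n) : Prop :=
  M^T = M /\ forall v : 'cV[R]_n, v != 0 -> 0 < quadf M v.

Definition loewner_le n (M1 M2 : 'M[R]_n) : Prop := psd (M2 - M1).

Definition conv_hull (V : lmodType R) n (S : 'I_n -> V) : set V :=
  [set s | exists lam : 'I_n -> R,
     [/\ forall l, 0 <= lam l, \sum_l lam l = 1 & s = \sum_l lam l *: S l]].

End linear_algebra.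

Section probability.
Context {R : realType}.

(** [F] is the family of sigma-algebras (given as set systems) of the family
    of random variables under consideration. *)
Definition mutually_independent d (T : measurableType d) (P : probability T R)
    (I : eqType) (F : I -> set (set T)) : Prop :=
  forall (J : seq I) (E : I -> set T), uniq J ->
    (forall j, j \in J -> F j (E j)) ->
    P (\bigcap_(j in [set` J]) E j) = (\prod_(j <- J) P (E j))%E.

Definition sigma_of d d' (T : measurableType d) (T' : measurableType d')
    (X : T -> T') : set (set T) :=
  preimage_set_system setT X measurable.

Definition mean_mx d (T : measurableType d) (P : probability T R) m n
    (M : T -> 'M[R]_(m, n)) : 'M[R]_(m, n) :=
  \matrix_(i, j) fine 'E_P[fun o => M o i j].

Definition cov_mx d (T : measurableType d) (P : probability T R) n
    (X : T -> 'cV[R]_n) : 'M[R]_n :=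
  mean_mx P (fun o => (X o - mean_mx P X) *m (X o - mean_mx P X)^T).

Definition square_integrable d (T : measurableType d) (P : probability T R) n
    (X : T -> 'cV[R]_n) : Prop :=
  forall i, ('E_P[fun o => ((X o i 0) ^+ 2)%R] < +oo)%E.

Definition standard_normal d (T : measurableType d) (P : probability T R) n
    (Z : T -> 'cV[R]_n) : Prop :=
  (forall i (U : set R), measurable U ->
     P [set o | U (Z o i 0)] = normal_prob 0 1 U) /\
  mutually_independent P (fun i : 'I_n => sigma_of (fun o => Z o i 0)).

(** [X ~ N(mu, Sigma)], [Sigma] possibly singular: [X] has the law of
    [mu + L Z] with [Z] a standard normal vector and [L L^T = Sigma].
    Laws are compared on measurable sets only: measures are total functions
    whose values elsewhere carry no meaning. *)
Definition gaussian d (T : measurableType d) (P : probability T R) n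
    (X : T -> 'cV[R]_n) (mu : 'cV[R]_n) (Sigma : 'M[R]_n) : Prop :=
  exists (m : nat) (L : 'M[R]_(n, m)) (d' : measure_display)
      (T' : measurableType d') (P' : probability T' R)
      (Z : {RV P' >-> 'cV[R]_m}),
    [/\ standard_normal P' Z, L *m L^T = Sigma &
        forall U : set 'cV[R]_n, measurable U ->
          P [set o | U (X o)] = P' [set o | U (mu + L *m Z o)]].

Definition iid_standard_normal d (T : measurableType d) (P : probability T R) n
    (w : nat -> T -> 'cV[R]_n) : Prop :=
  (forall t, gaussian P (w t) 0 1%:M) /\
  mutually_independent P (fun t => sigma_of (w t)).

Definition Phi (z : R) : R := fine (normal_prob 0 1 `]-oo, z]).

(** A genuine inverse on the range ]0, 1[ of [Phi], and [0] elsewhere. *)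
Definition Phi_inv : R -> R := 'pinv_(fun=> 0) [set: R] Phi.

End probability.

Section control.
Context {R : realType}.

Record affine_system nx nu nw := AffineSystem {
  sysA : 'M[R]_nx;
  sysB : 'M[R]_(nx, nu);
  sysD : 'M[R]_(nx, nw);
  sysr : 'cV[R]_nx }.

Definition sys_mx nx nu nw (s : affine_system nx nu nw) :
    'M[R]_(nx, nx + nu + nw + 1) :=
  row_mx (row_mx (row_mx (sysA s) (sysB s)) (sysD s)) (sysr s).

Definition step nx nu nw (s : affine_system nx nu nw) x u w : 'cV[R]_nx :=
  sysA s *m x + sysB s *m u + sysD s *m w + sysr s.

(** Individual chance constraints [Pr (alpha_i^T v <= beta_i) >= 1 - p_i]. *)
Record chance_data n m := ChanceData {
  alpha : 'I_m -> 'cV[R]_n;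
  beta : 'I_m -> R;
  risk : 'I_m -> R }.

Definition polyhedron n m (c : chance_data n m) : set 'cV[R]_n :=
  [set v | forall i, dotv (alpha c i) v <= beta c i].

Definition chance_constraints n m (c : chance_data n m) d
    (T : measurableType d) (P : probability T R) (X : T -> 'cV[R]_n) : Prop :=
  forall i, ((1 - risk c i)%:E <= P [set o | dotv (alpha c i) (X o) <= beta c i]%R)%E.

Definition tightened n m (c : chance_data n m) (S : 'M[R]_n) : set 'cV[R]_n :=
  [set v | forall i, dotv (alpha c i) v <=
     beta c i - Num.sqrt (quadf S (alpha c i)) * Phi_inv (1 - risk c i)].

Record ocp nx nu nw Nx Nu := OCP {
  horizon : nat;
  dyn : nat -> affine_system nx nu nw;
  xcon : chance_data nx Nx;
  ucon : chance_data nu Nu;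
  costQ : nat -> 'M[R]_nx;
  costR : nat -> 'M[R]_nu;
  xgoal : nat -> 'cV[R]_nx;
  termX : set 'cV[R]_nx;
  termSigma : 'M[R]_nx }.

Section ocp.
Context {nx nu nw Nx Nu : nat} (pb : ocp nx nu nw Nx Nu).

Definition stage_cost t (x : 'cV[R]_nx) (u : 'cV[R]_nu) : R :=
  quadf (costQ pb t) (x - xgoal pb t) + quadf (costR pb t) u.

(** Policies are indexed by absolute time; the problem posed at time [k] only
    involves those at times [k, ..., k + horizon - 1]. *)
Definition policies := nat -> {mfun 'cV[R]_nx >-> 'cV[R]_nu}.

(** [x] is a realization, on the probability space [(T, P)], of the predicted
    state process started at time [k] from [N(mu, Sigma)]. In the independent
    family, [None] stands for the initial state and [Some s] for the
    disturbance at time [k + s]. *)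
Definition prediction (k : nat) (mu : 'cV[R]_nx) (Sigma : 'M[R]_nx)
    (rho : policies) d (T : measurableType d) (P : probability T R)
    (w : nat -> {RV P >-> 'cV[R]_nw}) (x : nat -> {RV P >-> 'cV[R]_nx}) : Prop :=
  [/\ gaussian P (x k) mu Sigma,
      iid_standard_normal P w,
      mutually_independent P (fun i : option nat =>
        if i is Some s then sigma_of (w (k + s)%N) else sigma_of (x k)) &
      forall t, (k <= t < k + horizon pb)%N ->
        forall o, x t.+1 o = step (dyn pb t) (x t o) (rho t (x t o)) (w t o)].

(** Standing convention on policies: predicted states are Gaussian. Second
    moments of the controls are required to be finite, so that the cost and
    the moments of the controls are well defined. *)
Definition admissible k (rho : policies) d (T : measurableType d)
    (P : probability T R) (x : nat -> {RV P >-> 'cV[R]_nx}) : Prop :=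
  (forall t, (k <= t <= k + horizon pb)%N ->
     exists m S, gaussian P (x t) m S) /\
  (forall t, (k <= t < k + horizon pb)%N ->
     square_integrable P (fun o => rho t (x t o))).

Definition ocp_constraints k (rho : policies) d (T : measurableType d)
    (P : probability T R) (x : nat -> {RV P >-> 'cV[R]_nx}) : Prop :=
  [/\ forall t, (k <= t < k + horizon pb)%N ->
        chance_constraints (xcon pb) P (x t),
      forall t, (k <= t < k + horizon pb)%N ->
        chance_constraints (ucon pb) P (fun o => rho t (x t o)),
      termX pb (mean_mx P (x (k + horizon pb)%N)) &
      loewner_le (cov_mx P (x (k + horizon pb)%N)) (termSigma pb)].

Definition expected_cost k (rho : policies) d (T : measurableType d)
    (P : probability T R) (x : nat -> {RV P >-> 'cV[R]_nx}) : \bar R :=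
  (\sum_(k <= t < k + horizon pb)
     'E_P[fun o => stage_cost t (x t o) (rho t (x t o))])%E.

(** [rho] is a feasible point of the problem posed at time [k] with data
    [(mu, Sigma)], and its cost is [c]. Both depend only on the law of the
    predicted process, so the choice of the realization is immaterial. *)
Definition feasible_with_cost k mu Sigma (rho : policies) (c : \bar R) : Prop :=
  exists d (T : measurableType d) (P : probability T R)
      (w : nat -> {RV P >-> 'cV[R]_nw}) (x : nat -> {RV P >-> 'cV[R]_nx}),
    [/\ prediction k mu Sigma rho w x, admissible k rho x,
        ocp_constraints k rho x & c = expected_cost k rho x].

Definition feasible k mu Sigma : Prop :=
  exists rho c, feasible_with_cost k mu Sigma rho c.

Definition optimal k mu Sigma (rho : policies) : Prop :=
  exists2 c, feasible_with_cost k mu Sigma rho c &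
    forall rho' c', feasible_with_cost k mu Sigma rho' c' -> (c <= c')%E.

(** [(mu', Sigma')] are the mean and covariance predicted one step after [k]
    under [u = rho k (x)], [x ~ N(mu, Sigma)]. *)
Definition propagated k mu Sigma (rho : policies) mu' Sigma' : Prop :=
  forall d (T : measurableType d) (P : probability T R)
      (x : {RV P >-> 'cV[R]_nx}), gaussian P x mu Sigma ->
    let s := dyn pb k in
    let u o := rho k (x o) in
    let ubar := mean_mx P u in
    let Sxu := mean_mx P (fun o => (x o - mu) *m (u o - ubar)^T) in
    let Su := mean_mx P (fun o => (u o - ubar) *m (u o - ubar)^T) in
    mu' = sysA s *m mu + sysB s *m ubar + sysr s /\
    Sigma' = sysA s *m Sigma *m (sysA s)^T + sysA s *m Sxu *m (sysB s)^T
             + sysB s *m Sxu^T *m (sysA s)^T + sysB s *m Su *m (sysB s)^T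
             + sysD s *m (sysD s)^T.

End ocp.

Section terminal.
Context {nx nu nw Np : nat} (vert : 'I_Np -> affine_system nx nu nw).

Definition sdp_feasible (S : 'M[R]_nx) (Z : 'M[R]_(nu, nx)) : Prop :=
  forall l, let A := sysA (vert l) in let B := sysB (vert l) in
    let D := sysD (vert l) in
    psd (block_mx (S - D *m D^T) (A *m S + B *m Z)
                  (S *m A^T + Z^T *m B^T) S).

Definition sdp_solution S Z : Prop :=
  sdp_feasible S Z /\ forall S' Z', sdp_feasible S' Z' -> \tr S <= \tr S'.

Definition invariant_in (Xs : set 'cV[R]_nx) (Us : set 'cV[R]_nu)
    (X : set 'cV[R]_nx) : Prop :=
  X `<=` Xs /\
  forall mu, X mu -> exists2 v, Us v &
    forall l, X (sysA (vert l) *m mu + sysB (vert l) *m v + sysr (vert l)).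

Definition largest_invariant_in Xs Us X : Prop :=
  invariant_in Xs Us X /\ forall Y, invariant_in Xs Us Y -> Y `<=` X.

End terminal.

End control.

Arguments affine_system : clear implicits.
Arguments chance_data : clear implicits.
Arguments ocp : clear implicits.
Arguments policies : clear implicits.

(* Main.v *)
(* The closed loop and the prediction made at time k start from Gaussian states
   with the same mean and covariance, apply the same control and see the same
   noise, so x_k has the law of the predicted state and inherits its chance
   constraints; this only needs (P) to be feasible at every time.

   Feasibility propagates: after dropping its first stage, an optimal policy is
   completed by the terminal control v + L (x - m), where m is the mean of the
   last predicted state and v is given by the invariance of the terminal set.
   The semidefinite program bounds the new covariance by Sigma_f for every
   system in the convex hull of the vertices. The terminal set, being the
   largest invariant one, is convex, so it also contains the new mean for
   every such system. Since Phi^{-1}(1 - p) >= 0 for p <= 1/2, the tightened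
   constraints at covariance Sigma_f imply the chance constraints at every
   smaller covariance.

   A Gaussian law is determined by its mean and covariance: if
   L1 L1^T = L2 L2^T, then plane rotations, which preserve the law of a standard
   normal vector, clear the first row of each L outside its first
   entry; this entry and the first column are then determined by L L^T up to
   sign, and one concludes by induction on the number of rows. *)

From HB Require Import structures.
Require Import Defs.
From mathcomp Require Import all_boot all_order all_algebra.
From mathcomp Require Import all_classical all_reals all_analysis.
From mathcomp Require Import measurable_realfun ring lra.

Set Implicit Arguments.
Unset Strict Implicit.
Unset Printing Implicit Defensive.

Local Open Scope classical_set_scope.
Local Open Scope ring_scope.

(** * Measurability of matrix-valued maps *)

(** [feasible] only provides some realization of the prediction on some probability space, unrelated
    to that of the closed loop. Statements pass between the two spaces as equalities of laws, hence
    the need for uniqueness of the Gaussian law. Covariances may be singular (the initial one is 0),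
    so densities do not help for vectors; the form [mu + L Z] is used instead, with any number of
    columns in [L], and densities occur only for one or two independent standard normal coordinates.

    Policies are arbitrary measurable maps, so Gaussianity of the successor state does not follow
    from that of the current one: for the prediction it comes from the convention on policies, and
    the update formulas then identify mean and covariance. The closed loop inherits it through the
    joint law of [x_k] and [w_k], which is why independence of [x_k] from all disturbances from time
    [k] on is carried along in the induction. *)

Section matrix_measurability.
Context {R : realType}.

Lemma measurable_mx_entry m n (i : 'I_m) (j : 'I_n) :
  measurable_fun [set: 'M[R]_(m, n)] (fun M => M i j).
Proof.
move=> _ U mU; apply: sub_sigma_algebra; exists (i, j) => //=.
by exists U.
Qed.

Lemma measurable_mxP d (T : measurableType d) m n (f : T -> 'M[R]_(m, n)) :
  (forall i j, measurable_fun setT (fun o => f o i j)) ->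
  measurable_fun setT f.
Proof.
move=> mf; apply: (measurability (@mx_cylinder R m n)) => //.
move=> _ [_ [[i j] _ /= [U mU <-]] <-].
by have := mf i j measurableT U mU; rewrite !setTI.
Qed.

Lemma measurable_entry d (T : measurableType d) m n (f : T -> 'M[R]_(m, n)) i j :
  measurable_fun setT f -> measurable_fun setT (fun o => f o i j).
Proof. by move=> mf; apply: (measurableT_comp (measurable_mx_entry i j)). Qed.

Lemma measurable_mulmx d (T : measurableType d) m n p
    (f : T -> 'M[R]_(m, n)) (g : T -> 'M[R]_(n, p)) :
  measurable_fun setT f -> measurable_fun setT g ->
  measurable_fun setT (fun o => f o *m g o).
Proof.
move=> mf mg; apply: measurable_mxP => i j.
under eq_fun do rewrite mxE.
apply: measurable_sum => k; apply: measurable_funM; exact: measurable_entry.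
Qed.

Lemma measurable_addmx d (T : measurableType d) m n
    (f g : T -> 'M[R]_(m, n)) :
  measurable_fun setT f -> measurable_fun setT g ->
  measurable_fun setT (fun o => f o + g o).
Proof.
move=> mf mg; apply: measurable_mxP => i j.
under eq_fun do rewrite mxE.
by apply: measurable_funD; exact: measurable_entry.
Qed.

Lemma measurable_trmx d (T : measurableType d) m n (f : T -> 'M[R]_(m, n)) :
  measurable_fun setT f -> measurable_fun setT (fun o => (f o)^T).
Proof.
move=> mf; apply: measurable_mxP => i j.
under eq_fun do rewrite mxE; exact: measurable_entry.
Qed.

Lemma measurable_col_mx d (T : measurableType d) m1 m2 n
    (f : T -> 'M[R]_(m1, n)) (g : T -> 'M[R]_(m2, n)) :
  measurable_fun setT f -> measurable_fun setT g ->
  measurable_fun setT (fun o => col_mx (f o) (g o)).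
Proof.
move=> mf mg; apply: measurable_mxP => i j.
under eq_fun do rewrite mxE.
by case: splitP => k _; exact: measurable_entry.
Qed.

Lemma measurable_dotv d (T : measurableType d) n (a : 'cV[R]_n)
    (f : T -> 'cV[R]_n) :
  measurable_fun setT f -> measurable_fun setT (fun o => dotv a (f o)).
Proof.
by move=> mf; apply/measurable_entry/measurable_mulmx.
Qed.

Lemma measurable_step d (T : measurableType d) nx nu nw
    (s : affine_system R nx nu nw) (x : T -> 'cV[R]_nx) (u : T -> 'cV[R]_nu)
    (w : T -> 'cV[R]_nw) :
  measurable_fun setT x -> measurable_fun setT u -> measurable_fun setT w ->
  measurable_fun setT (fun o => step s (x o) (u o) (w o)).
Proof.
move=> mx mu mw; apply: measurable_addmx => //.
by do !apply: measurable_addmx => //; exact: measurable_mulmx.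
Qed.

End matrix_measurability.

(** * Laws and independence *)

Section laws.
Context {R : realType}.
Local Open Scope ereal_scope.

(** [distribution] and random variables want bundled maps; this bundles a map with a measurability
    proof obtained on the spot. *)
Definition mfun_of d d' (T : measurableType d) (S : measurableType d')
    (f : T -> S) (mf : measurable_fun setT f) : {mfun T >-> S} :=
  HB.pack f (isMeasurableFun.Build _ _ _ _ f mf).

Definition same_law d1 d2 d (T1 : measurableType d1) (T2 : measurableType d2)
    (S : measurableType d) (P1 : probability T1 R) (P2 : probability T2 R)
    (X1 : T1 -> S) (X2 : T2 -> S) : Prop :=
  forall U, measurable U -> P1 (X1 @^-1` U) = P2 (X2 @^-1` U).

Definition indep_pair d d1 d2 (T : measurableType d) (S1 : measurableType d1)
    (S2 : measurableType d2) (P : probability T R) (X : T -> S1) (Y : T -> S2) :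
    Prop :=
  forall A B, measurable A -> measurable B ->
    P (X @^-1` A `&` Y @^-1` B) = P (X @^-1` A) * P (Y @^-1` B).

Lemma measurable_preimage d d1 (T : measurableType d) (S : measurableType d1)
    (X : T -> S) U :
  measurable_fun setT X -> measurable U -> measurable (X @^-1` U).
Proof. by move=> mX mU; rewrite -[X in measurable X]setTI; exact: mX. Qed.

Lemma same_law_comp d1 d2 d d' (T1 : measurableType d1) (T2 : measurableType d2)
    (S : measurableType d) (S' : measurableType d') (P1 : probability T1 R)
    (P2 : probability T2 R) (X1 : T1 -> S) (X2 : T2 -> S) (f : S -> S') :
  measurable_fun setT f -> same_law P1 P2 X1 X2 ->
  same_law P1 P2 (fun o => f (X1 o)) (fun o => f (X2 o)).
Proof.
by move=> mf X12 U mU; apply: (X12 (f @^-1` U)); exact: measurable_preimage.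
Qed.

(** No integrability is assumed: the positive and the negative part each depend on the pushforward
    measure only. *)
Lemma same_law_integral d1 d2 d (T1 : measurableType d1)
    (T2 : measurableType d2) (S : measurableType d) (P1 : probability T1 R)
    (P2 : probability T2 R) (X1 : T1 -> S) (X2 : T2 -> S) (f : S -> \bar R) :
  measurable_fun setT X1 -> measurable_fun setT X2 -> measurable_fun setT f ->
  same_law P1 P2 X1 X2 ->
  \int[P1]_o f (X1 o) = \int[P2]_o f (X2 o).
Proof.
move=> mX1 mX2 mf X12.
suff ge0_law (g : S -> \bar R) : measurable_fun setT g -> (forall x, 0 <= g x) ->
    \int[P1]_o g (X1 o) = \int[P2]_o g (X2 o).
  rewrite integralE [RHS]integralE.
  congr (_ - _).
  - under eq_integral do rewrite funeposE -funeposE.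
    under [in RHS]eq_integral do rewrite funeposE -funeposE.
    by apply: ge0_law => //; exact: measurable_funepos.
  - under eq_integral do rewrite funenegE -funenegE.
    under [in RHS]eq_integral do rewrite funenegE -funenegE.
    by apply: ge0_law => //; exact: measurable_funeneg.
move=> mg g0.
have E d0 (T : measurableType d0) (P : probability T R) (X : T -> S)
    (mX : measurable_fun setT X) :
    \int[P]_o g (X o) = \int[pushforward P X]_y g y.
  by rewrite ge0_integral_pushforward.
rewrite (E _ _ _ _ mX1) (E _ _ _ _ mX2).
by apply: eq_measure_integral => A mA _; exact: X12.
Qed.

Lemma indep_pair_comp d d1 d2 d1' d2' (T : measurableType d)
    (S1 : measurableType d1) (S2 : measurableType d2)
    (S1' : measurableType d1') (S2' : measurableType d2')
    (P : probability T R) (X : T -> S1) (Y : T -> S2) (f : S1 -> S1')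
    (g : S2 -> S2') :
  measurable_fun setT f -> measurable_fun setT g -> indep_pair P X Y ->
  indep_pair P (fun o => f (X o)) (fun o => g (Y o)).
Proof.
move=> mf mg XY A B mA mB.
by apply: (XY (f @^-1` A) (g @^-1` B)); exact: measurable_preimage.
Qed.

(** Rectangles generate, are stable under intersection and include the whole space, so they
    determine a finite measure. *)
Lemma rectangle_measure_unique d1 d2 (S1 : measurableType d1)
    (S2 : measurableType d2)
    (m1 m2 : {finite_measure set (S1 * S2)%type -> \bar R}) :
  (forall A B, measurable A -> measurable B -> m1 (A `*` B) = m2 (A `*` B)) ->
  forall W, measurable W -> m1 W = m2 W.
Proof.
move=> m12 W mW.
pose G := [set A `*` B | A in @measurable _ S1 & B in @measurable _ S2].
apply: (measure_unique G (fun=> setT)) => //.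
- by rewrite measurable_prod_measurableType.
- move=> _ _ [A1 mA1 [B1 mB1 <-]] [A2 mA2 [B2 mB2 <-]].
  exists (A1 `&` A2); first exact: measurableI.
  by exists (B1 `&` B2); [exact: measurableI|rewrite setXI].
- by move=> _; exists setT => //; exists setT => //; rewrite setXTT.
- by rewrite bigcup_const//; exists 0%N.
- by move=> _ [A mA [B mB <-]]; exact: m12.
- by move=> _; rewrite -ge0_fin_numE//; exact: fin_num_measure.
Qed.

(** This is how the joint law of state and disturbance passes from the prediction to the closed
    loop. *)
Lemma same_law_pair d d' d1 d2 (T : measurableType d) (T' : measurableType d')
    (S1 : measurableType d1) (S2 : measurableType d2) (P : probability T R)
    (P' : probability T' R) (X : T -> S1) (Y : T -> S2) (X' : T' -> S1)
    (Y' : T' -> S2) :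
  measurable_fun setT X -> measurable_fun setT Y ->
  measurable_fun setT X' -> measurable_fun setT Y' ->
  indep_pair P X Y -> indep_pair P' X' Y' ->
  same_law P P' X X' -> same_law P P' Y Y' ->
  same_law P P' (fun o => (X o, Y o)) (fun o => (X' o, Y' o)).
Proof.
move=> mX mY mX' mY' XY XY' XX' YY' W mW.
have mXY := measurable_fun_pair mX mY; have mXY' := measurable_fun_pair mX' mY'.
pose Z := mfun_of mXY.
pose Z' := mfun_of mXY'.
apply: (@rectangle_measure_unique _ _ _ _
  (distribution P Z) (distribution P' Z')) => // A B mA mB.
change (P (X @^-1` A `&` Y @^-1` B) = P' (X' @^-1` A `&` Y' @^-1` B)).
by rewrite XY// XY'// XX'// YY'.
Qed.

(** Both sides are finite measures in [W] that agree on the intersection-stable generating family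
    [C]. *)
Lemma indep_event_generated d d1 (T : measurableType d)
    (S : measurableType d1) (P : probability T R) (X : T -> S) (G : set T)
    (C : set (set S)) :
  measurable = <<s C >> -> setI_closed C -> C setT ->
  measurable_fun setT X -> measurable G ->
  (forall A, C A -> P (X @^-1` A `&` G) = P (X @^-1` A) * P G) ->
  forall W, measurable W -> P (X @^-1` W `&` G) = P (X @^-1` W) * P G.
Proof.
move=> CS CI CT mX mG XG W mW.
pose Z := mfun_of mX.
have PG : P G \is a fin_num by exact: fin_num_measure.
pose c := NngNum (fine_ge0 (measure_ge0 P G)).
have cE : c%:num%:E = P G by rewrite /= fineK.
pose m1 := pushforward (mrestr P mG) Z.
pose m2 := mscale c (distribution P Z).
suff : m1 W = m2 W.
  rewrite [_ * P G]muleC -cE; exact.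
apply: (measure_unique C (fun=> setT)) => //.
- by rewrite bigcup_const//; exists 0%N.
- move=> A CA; change (P (X @^-1` A `&` G) = c%:num%:E * P (X @^-1` A)).
  by rewrite cE XG// muleC.
- move=> _; rewrite /= /m1 /pushforward /mrestr preimage_setT setTI.
  by rewrite -ge0_fin_numE.
Qed.

(** Mutual independence yields product formulas only; this turns one into independence of the pair
    from [G], so that maps mixing [X] and [Y] can be applied. *)
Lemma indep_event_pair d d1 d2 (T : measurableType d) (S1 : measurableType d1)
    (S2 : measurableType d2) (P : probability T R) (X : T -> S1) (Y : T -> S2)
    (G : set T) :
  measurable_fun setT X -> measurable_fun setT Y -> measurable G ->
  indep_pair P X Y ->
  (forall A B, measurable A -> measurable B ->
     P (X @^-1` A `&` Y @^-1` B `&` G) =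
     P (X @^-1` A) * P (Y @^-1` B) * P G) ->
  forall W, measurable W ->
    P ((fun o => (X o, Y o)) @^-1` W `&` G) =
    P ((fun o => (X o, Y o)) @^-1` W) * P G.
Proof.
move=> mX mY mG XY XYG.
apply: (@indep_event_generated _ _ _ _ _ _ _
  [set A `*` B | A in @measurable _ S1 & B in @measurable _ S2]) => //.
- exact: measurable_prod_measurableType.
- move=> _ _ [A1 mA1 [B1 mB1 <-]] [A2 mA2 [B2 mB2 <-]].
  exists (A1 `&` A2); first exact: measurableI.
  by exists (B1 `&` B2); [exact: measurableI|rewrite setXI].
- by exists setT => //; exists setT => //; rewrite setXTT.
- exact: measurable_fun_pair.
- move=> _ [A mA [B mB <-]].
  change (P (X @^-1` A `&` Y @^-1` B `&` G) =
    P (X @^-1` A `&` Y @^-1` B) * P G).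
  by rewrite XYG// XY.
Qed.

End laws.

(** * Independence of a state from the coming disturbances *)

Section streams.
Context {R : realType}.
Local Open Scope ereal_scope.

(* [bigcap_seq] asks for a [choiceType]. *)
Lemma bigcap_seqE (T : Type) (I : eqType) (J : seq I) (E : I -> set T) :
  \bigcap_(i in [set` J]) E i = \big[setI/setT]_(i <- J) E i.
Proof.
elim: J => [|i J IHJ]; first by rewrite big_nil set_nil bigcap_set0.
rewrite big_cons -IHJ; apply/seteqP; split=> o /=.
  move=> Eo; split; first by apply: Eo; rewrite /= mem_head.
  by move=> j jJ; apply: Eo; rewrite /= inE; apply/orP; right.
by move=> [Ei EJ] j; rewrite /= inE => /orP[/eqP->//|]; exact: EJ.
Qed.

(** The independence clause of [prediction], with [k] free so that it can be moved forward in
    time. *)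
Definition stream_indep d d1 d2 (T : measurableType d) (P : probability T R)
    (S1 : measurableType d1) (S2 : measurableType d2)
    (X : T -> S1) (W : nat -> T -> S2) (k : nat) : Prop :=
  mutually_independent P (fun i : option nat =>
    if i is Some s then sigma_of (W (k + s)%N) else sigma_of X).

Lemma mutually_independentE d (T : measurableType d) (P : probability T R)
    (I : eqType) (F : I -> set (set T)) : mutually_independent P F ->
  forall (J : seq I) (E : I -> set T), uniq J ->
    (forall j, j \in J -> F j (E j)) ->
    P (\big[setI/setT]_(j <- J) E j) = \prod_(j <- J) P (E j).
Proof. by move=> FP J E uJ FE; rewrite -FP// bigcap_seqE. Qed.

(** [mutually_independent] quantifies over lists in any order; isolating [None] lets the state be
    treated apart from the noises. *)
Lemma perm_option_seq (I : eqType) (J : seq (option I)) : uniq J ->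
  exists J' : seq I, [/\ uniq J', forall s, s \in J' -> Some s \in J &
    perm_eq J (if None \in J then None :: map some J' else map some J')].
Proof.
move=> uJ; pose J' := pmap id J.
have J'E s : (s \in J') = (Some s \in J) by rewrite mem_pmap map_id.
have someI : injective (@Some I) by move=> ? ? [].
have uJ' : uniq J' by apply: (@pmap_uniq _ _ id some) => //; case.
have NJ' : None \notin map some J' by apply/mapP => -[].
exists J'; split=> // [s|]; first by rewrite J'E.
case: ifPn => NJ; apply: uniq_perm => //=.
- by rewrite NJ' map_inj_uniq.
- by case=> [s|]; rewrite inE ?NJ//= mem_map ?J'E.
- by rewrite map_inj_uniq.
- by case=> [s|]; [rewrite mem_map ?J'E|rewrite (negbTE NJ) (negbTE NJ')].
Qed.

(** A constant variable only generates the events [setT] and [set0]. *)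
Lemma stream_indep_cst d d1 d2 (T : measurableType d) (P : probability T R)
    (S1 : measurableType d1) (S2 : measurableType d2)
    (X : T -> S1) (c : S1) (W : nat -> T -> S2) :
  (forall o, X o = c) ->
  mutually_independent P (fun t => sigma_of (W t)) -> stream_indep P X W 0.
Proof.
move=> Xc WP J E uJ FE.
rewrite bigcap_seqE.
have [J' [uJ' J'J JJ']] := perm_option_seq uJ.
have PJ' : P (\big[setI/setT]_(j <- map some J') E j) =
    \prod_(j <- map some J') P (E j).
  rewrite !big_map.
  apply: (mutually_independentE WP (E := fun s => E (Some s))) => // j jJ'.
  by apply: (FE (Some j)); exact: J'J.
rewrite !(perm_big _ JJ')/=; case: ifPn => // NJ.
rewrite !big_cons -PJ'.
have [U mU EN] := FE _ NJ.
have [Uc|Uc] := pselect (U c).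
  rewrite (_ : E None = setT) ?setTI ?probability_setT ?mul1e//.
  by rewrite -EN setTI -subTset => o _ /=; rewrite Xc.
rewrite (_ : E None = set0) ?set0I ?measure0 ?mul0e//.
by rewrite -EN setTI -subset0 => o /=; rewrite Xc.
Qed.

Lemma stream_indep_pair d d1 d2 (T : measurableType d) (P : probability T R)
    (S1 : measurableType d1) (S2 : measurableType d2)
    (X : T -> S1) (W : nat -> T -> S2) k :
  stream_indep P X W k -> indep_pair P X (W k).
Proof.
move=> XW A B mA mB.
have := mutually_independentE XW (J := [:: None; Some 0%N])
  (E := fun i => if i is Some _ then W k @^-1` B else X @^-1` A).
rewrite !big_cons !big_nil setIT mule1; apply => //.
move=> [s|]; rewrite !inE/=; last by move=> _; exists A; rewrite ?setTI.
by move=> /eqP[->]; exists B; rewrite ?setTI ?addn0.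
Qed.

(** [Y] is a function of [X] and [W k], and this pair is independent of every event [G] about the
    noises after time [k]. *)
Lemma stream_indep_step d d1 d2 d3 (T : measurableType d) (P : probability T R)
    (S1 : measurableType d1) (S2 : measurableType d2) (S3 : measurableType d3)
    (X : T -> S1) (W : nat -> T -> S2) k (f : S1 * S2 -> S3) (Y : T -> S3) :
  measurable_fun setT X -> (forall t, measurable_fun setT (W t)) ->
  measurable_fun setT f -> (forall o, Y o = f (X o, W k o)) ->
  stream_indep P X W k -> stream_indep P Y W k.+1.
Proof.
move=> mX mW mf /funext -> {Y} XW J E uJ FE.
have PXW := stream_indep_pair XW.
rewrite bigcap_seqE.
have [J' [uJ' J'J JJ']] := perm_option_seq uJ.
pose G := \big[setI/setT]_(j <- J') E (Some j).
have FG j : j \in J' -> sigma_of (W (k + j.+1)%N) (E (Some j)).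
  by move=> jJ'; rewrite -addSnnS; apply: (FE (Some j)); exact: J'J.
have PG : P G = \prod_(j <- J') P (E (Some j)).
  (* Noise number [s] counted from [k.+1] is noise number [s.+1] counted from [k]. *)
  pose E' i := if i is Some s.+1 then E (Some s) else setT.
  transitivity (P (\big[setI/setT]_(j <- map (some \o S) J') E' j)).
    by rewrite big_map.
  rewrite (mutually_independentE XW) ?big_map//.
    by rewrite map_inj_uniq// => ? ? [].
  by move=> _ /mapP[s /FG Fs ->].
have mG : measurable G.
  rewrite /G big_seq; apply: bigsetI_measurable => j /FG[U mU <-].
  by rewrite setTI; exact: measurable_preimage.
have XWG A B : measurable A -> measurable B ->
    P (X @^-1` A `&` W k @^-1` B `&` G) =
    P (X @^-1` A) * P (W k @^-1` B) * P G.
  move=> mA mB.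
  pose E' i := match i with
    | None => X @^-1` A | Some 0%N => W k @^-1` B | Some s.+1 => E (Some s) end.
  have := mutually_independentE XW
    (J := None :: Some 0%N :: map (some \o S) J') (E := E').
  rewrite !big_cons !big_map -PG setIA muleA; apply.
    rewrite /= !inE/= map_inj_uniq ?uJ' ?andbT; last by move=> ? ? [].
    by apply/andP; split; apply/mapP => -[].
  move=> i; rewrite !inE => /or3P[/eqP->|/eqP->|/mapP[s /FG Fs ->]]//.
  - by exists A; rewrite ?setTI.
  - by exists B; rewrite ?setTI ?addn0.
rewrite !(perm_big _ JJ')/=; case: ifPn => NJ; last by rewrite !big_map.
rewrite !big_cons !big_map -PG.
have [U mU <-] := FE _ NJ; rewrite setTI.
have /= := indep_event_pair mX (mW k) mG PXW XWG (measurable_preimage mf mU).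
exact.
Qed.

End streams.

(** * The normal distribution on the line *)

Section normal.
Context {R : realType}.
Notation lambda := (@lebesgue_measure R).
Notation N01 := (@normal_prob R 0 1).
Local Open Scope ereal_scope.

(** The Radon-Nikodym derivative and the density have equal integrals over every measurable set,
    hence agree almost everywhere. *)
Lemma ge0_integral_normal_prob (m s : R) (f : R -> \bar R) :
  measurable_fun setT f -> (forall x, 0 <= f x) ->
  \int[normal_prob m s]_x f x = \int[lambda]_x (f x * (normal_pdf m s x)%:E).
Proof.
move=> mf f0; have dom := normal_prob_dominates m s.
rewrite -(Radon_Nikodym_SigmaFinite.change_of_variables dom)//.
have intg := Radon_Nikodym_SigmaFinite.f_integrable dom.
have mpdf : measurable_fun setT (fun x => (normal_pdf m s x)%:E : \bar R).
  by apply/measurable_EFinP; exact: measurable_normal_pdf.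
apply: ae_eq_integral => //.
- by apply: emeasurable_funM => //; exact: (measurable_int lambda).
- exact: emeasurable_funM.
apply: ae_eqe_mul2l; apply: integral_ae_eq => // E _ mE.
by rewrite -Radon_Nikodym_SigmaFinite.f_integral.
Qed.

Lemma measurable_affine (a b : R) : measurable_fun setT (fun x : R => a * x + b)%R.
Proof. by apply: measurable_funD => //; exact: measurable_funM. Qed.

(** The pushforward of [lambda] under [a x + b], scaled by [|a|], gives each []u, v]] its length,
    which characterizes Lebesgue measure. *)
Lemma lebesgue_measure_affine (a b : R) (A : set R) : a != 0%R -> measurable A ->
  lambda A = `|a|%:E * lambda ((fun x => a * x + b)%R @^-1` A).
Proof.
move=> a0 mA.
pose g : R -> measurableTypeR R := (fun x => a * x + b)%R.
have mg : measurable_fun [set: measurableTypeR R] g by exact: measurable_affine.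
pose h : {mfun measurableTypeR R >-> measurableTypeR R} := mfun_of mg.
pose c := NngNum (normr_ge0 a).
have := @lebesgue_measure_unique R (mscale c (pushforward lambda h)).
apply => // _ [[u v] _ <-].
change (lambda `]u, v] = `|a|%:E * lambda (g @^-1` `]u, v])).
have [agt0|alt0|a00] := ltgtP 0%R a; last by rewrite -a00 eqxx in a0.
- rewrite (_ : g @^-1` _ = `]((u - b) / a)%R, ((v - b) / a)%R]%classic); last first.
    apply/seteqP; split => x/=; rewrite !in_itv/= /g;
      by rewrite ltr_pdivrMr// ler_pdivlMr// ltrBlDr lerBrDr mulrC.
  rewrite !lebesgue_measure_itv/= !lte_fin ltr_pM2r ?invr_gt0// ltrD2r.
  case: ifP => _; last by rewrite mule0.
  by rewrite -!EFinB -EFinM gtr0_norm//; congr EFin; field; rewrite gt_eqF.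
- rewrite (_ : g @^-1` _ = `[((v - b) / a)%R, ((u - b) / a)%R[%classic); last first.
    apply/seteqP; split => x/=; rewrite !in_itv/= /g;
      by rewrite ler_ndivrMr// ltr_ndivlMr// ltrBlDr lerBrDr mulrC andbC.
  rewrite !lebesgue_measure_itv/= !lte_fin ltr_nM2r ?invr_lt0// ltrD2r.
  case: ifP => _; last by rewrite mule0.
  by rewrite -!EFinB -EFinM ltr0_norm//; congr EFin; field; rewrite lt_eqF.
Qed.

Lemma ge0_integral_affine (a b : R) (f : R -> \bar R) : a != 0%R ->
  measurable_fun setT f -> (forall x, 0 <= f x) ->
  \int[lambda]_x f x = `|a|%:E * \int[lambda]_x f (a * x + b)%R.
Proof.
move=> a0 mf f0.
pose g : R -> measurableTypeR R := (fun x => a * x + b)%R.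
have mg : measurable_fun [set: measurableTypeR R] g by exact: measurable_affine.
pose c := NngNum (normr_ge0 a).
pose m : {measure set (measurableTypeR R) -> \bar R} :=
  measure_function_pushforward__canonical__measure_function_Measure lambda mg.
transitivity (\int[mscale c m]_x f x).
  by apply: eq_measure_integral => A mA _; exact: lebesgue_measure_affine.
rewrite ge0_integral_mscale//; congr (_ * _).
by rewrite ge0_integral_pushforward.
Qed.

End normal.

(** * Rotation invariance of the planar normal law *)

Section rotation.
Context {R : realType}.
Notation lambda := (@lebesgue_measure R).
Local Open Scope ereal_scope.

Lemma ge0_lebesgue_swap (f : R * R -> \bar R) :
  measurable_fun setT f -> (forall z, 0 <= f z) ->
  \int[lambda]_y \int[lambda]_x f (x, y) = \int[lambda]_x \int[lambda]_y f (x, y).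
Proof.
by move=> mf f0; rewrite (fubini_tonelli (m1 := lambda) (m2 := lambda) f).
Qed.

Lemma measurable_linear2 (a b : R) :
  measurable_fun setT (fun z : R * R => a * z.1 + b * z.2)%R.
Proof. by apply: measurable_funD; exact: measurable_funM. Qed.

(** For [c != 0] the rotation is undone one variable at a time: first [x := (x - s y) / c], then,
    after exchanging the integrals, [y := c y + s x]. The factors [|c^-1|] and [|c|] cancel. *)
Lemma ge0_lebesgue_rotation (c s : R) (f : R * R -> \bar R) :
  (c ^+ 2 + s ^+ 2 = 1)%R -> measurable_fun setT f -> (forall z, 0 <= f z) ->
  \int[lambda]_y \int[lambda]_x f (c * x + s * y, c * y - s * x)%R =
  \int[lambda]_x \int[lambda]_y f (x, y).
Proof.
move=> cs1 mf f0.
have mfL (a b a' b' : R) :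
    measurable_fun setT (fun z : R * R =>
      f (a * z.1 + b * z.2, a' * z.1 + b' * z.2)%R).
  apply: (measurableT_comp mf); apply: measurable_fun_pair;
  exact: measurable_linear2.
have mfl x (a b : R) : measurable_fun setT (fun y : R => f (x, a * y + b)%R).
  apply: (measurableT_comp mf); apply: measurable_fun_pair => //.
  exact: measurable_affine.
(* A quarter turn: the coordinates are exchanged and possibly reflected, and the iterated integrals
   are already in the right order. *)
have [c0|c0] := eqVneq c 0%R.
  have s0 : s != 0%R.
    by apply/eqP => s0; move: cs1; rewrite c0 s0 !expr0n addr0 => /eqP; rewrite eq_sym oner_eq0.
  have s1 : (`|s| = 1)%R.
    by apply/eqP; rewrite -sqr_norm_eq1 -cs1 c0 expr0n add0r.
  have mF : measurable_fun setT (fun x : R => \int[lambda]_y f (x, y)).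
    exact: (measurable_fun_fubini_tonelli_F (m2 := lambda) f).
  rewrite [RHS](ge0_integral_affine 0%R s0)//; last first.
    by move=> x; exact: integral_ge0.
  rewrite s1 mul1e; apply: eq_integral => y _.
  rewrite [RHS](@ge0_integral_affine _ (- s)%R 0%R) ?oppr_eq0//; last first.
    exact: measurable_fun_pair2.
  rewrite normrN s1 mul1e; apply: eq_integral => x _.
  by rewrite c0 !mul0r add0r addr0 mulNr addr0 add0r.
have ca0 : (c^-1 != 0)%R by rewrite invr_eq0.
(* The integrand after the first substitution, simplified with [c^2 + s^2 = 1]. *)
pose g (z : R * R) := f (z.1, c^-1 * z.2 + - (s / c) * z.1)%R.
have mg : measurable_fun setT g.
  rewrite (_ : g = fun z => f (1 * z.1 + 0 * z.2, - (s / c) * z.1 + c^-1 * z.2)%R).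
    exact: mfL.
  by apply/funext => z; rewrite /g mul1r mul0r addr0 addrC.
have g0 z : 0 <= g z by exact: f0.
transitivity (\int[lambda]_y (`|c^-1|%:E * \int[lambda]_x g (x, y))).
  apply: eq_integral => y _.
  rewrite (@ge0_integral_affine _ c^-1%R (- (s / c) * y)%R)//; last first.
    rewrite (_ : (fun x => _) = fun x =>
      f (c * x + s * y, (- s) * x + c * y)%R).
      apply: (measurableT_comp mf); apply: measurable_fun_pair;
      exact: measurable_affine.
    by apply/funext => x; rewrite mulNr (addrC (- _)%R).
  congr (_ * _); apply: eq_integral => x _; congr (f (_, _)) => /=.
    by field.
  transitivity ((c ^+ 2 + s ^+ 2) / c * y - (s / c) * x)%R; first by field.
  by rewrite cs1 mul1r mulNr.
rewrite ge0_integralZl//; last 2 first.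
- exact: (measurable_fun_fubini_tonelli_G (m1 := lambda) g).
- by move=> y _; exact: integral_ge0.
rewrite (ge0_lebesgue_swap mg)// -ge0_integralZl//; last 2 first.
- exact: (measurable_fun_fubini_tonelli_F (m2 := lambda) g).
- by move=> y _; exact: integral_ge0.
apply: eq_integral => x _.
rewrite (@ge0_integral_affine _ c (s * x)%R)//; last first.
  exact: measurable_fun_pair2.
rewrite muleA -EFinM -normrM mulVf// normr1 mul1e.
by apply: eq_integral => y _; congr (f (_, _)) => /=; field.
Qed.

Local Notation phi := (@normal_pdf R 0 1).

Lemma normal_pdf_rotation (c s x y : R) : (c ^+ 2 + s ^+ 2 = 1)%R ->
  (phi (c * x + s * y) * phi (c * y - s * x) = phi x * phi y)%R.
Proof.
move=> cs1; rewrite normal_pdfE ?oner_eq0//=.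
rewrite mulrACA [RHS]mulrACA; congr (_ * _)%R.
rewrite /normal_fun !subr0 -!expRD; congr expR.
have -> : (- x ^+ 2 / (1 ^+ 2 *+ 2) + - y ^+ 2 / (1 ^+ 2 *+ 2) =
  - (c ^+ 2 + s ^+ 2) * x ^+ 2 / (1 ^+ 2 *+ 2) +
  - (c ^+ 2 + s ^+ 2) * y ^+ 2 / (1 ^+ 2 *+ 2))%R by rewrite cs1 !mulN1r.
by ring.
Qed.

Lemma measurable_idR : measurable_fun [set: measurableTypeR R] (id : _ -> R).
Proof. exact: measurable_id. Qed.

(* [normal_prob 0 1], which lives on [measurableTypeR R], moved to the
   measurable structure inferred for [R] itself. *)
Definition std_normal : probability R R :=
  distribution (normal_prob 0 1) (mfun_of measurable_idR).
Local Notation N01 := std_normal.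

Lemma std_normalE U : N01 U = normal_prob 0 1 U.
Proof. by []. Qed.

Lemma ge0_integral_std_normal (f : R -> \bar R) :
  measurable_fun setT f -> (forall x, 0 <= f x) ->
  \int[N01]_x f x = \int[lambda]_x (f x * (phi x)%:E).
Proof.
by move=> mf f0; rewrite -ge0_integral_normal_prob// ge0_integral_distribution.
Qed.

Lemma ge0_integral_normal_prod (f : R * R -> \bar R) :
  measurable_fun setT f -> (forall z, 0 <= f z) ->
  \int[N01 \x N01]_z f z =
  \int[lambda]_y \int[lambda]_x (f (x, y) * (phi x * phi y)%:E).
Proof.
move=> mf f0.
rewrite (fubini_tonelli2 f)//.
have phi0 x : 0 <= (phi x)%:E by rewrite lee_fin normal_pdf_ge0.
have mphi : measurable_fun setT (fun x => (phi x)%:E).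
  by apply/measurable_EFinP; exact: measurable_normal_pdf.
rewrite /fubini_G ge0_integral_std_normal//; last 2 first.
- exact: measurable_fun_fubini_tonelli_G.
- by move=> y; exact: integral_ge0.
apply: eq_integral => y _.
have mfy : measurable_fun setT (fun x => f (x, y)) by exact: measurable_fun_pair1.
rewrite ge0_integral_std_normal// -ge0_integralZr//; last 2 first.
- by apply: emeasurable_funM.
- by move=> x _; exact: mule_ge0.
by apply: eq_integral => x _; rewrite EFinM muleA.
Qed.

Lemma ge0_normal_rotation (c s : R) (f : R * R -> \bar R) :
  (c ^+ 2 + s ^+ 2 = 1)%R -> measurable_fun setT f -> (forall z, 0 <= f z) ->
  \int[N01 \x N01]_z f (c * z.1 + s * z.2, c * z.2 - s * z.1)%R =
  \int[N01 \x N01]_z f z.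
Proof.
move=> cs1 mf f0.
pose F (z : R * R) := f z * (phi z.1 * phi z.2)%:E.
have mF : measurable_fun setT F.
  apply: emeasurable_funM => //; apply/measurable_EFinP/measurable_funM;
  by apply: measurableT_comp => //; exact: measurable_normal_pdf.
have F0 z : 0 <= F z by rewrite mule_ge0// lee_fin mulr_ge0// normal_pdf_ge0.
pose g (z : R * R) := f (c * z.1 + s * z.2, c * z.2 - s * z.1)%R.
have mg : measurable_fun setT g.
  apply: (measurableT_comp mf); apply: measurable_fun_pair.
    exact: measurable_linear2.
  rewrite (_ : (fun z : R * R => _) = fun z => (- s * z.1 + c * z.2)%R).
    exact: measurable_linear2.
  by apply/funext => z; rewrite mulNr (addrC (- _)%R).
have g0 z : 0 <= g z by exact: f0.
apply: (etrans (ge0_integral_normal_prod mg g0)).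
apply/esym; apply: (etrans (ge0_integral_normal_prod mf f0)).
apply: (etrans (ge0_lebesgue_swap mF F0)).
apply: (etrans (esym (ge0_lebesgue_rotation cs1 mF F0))).
apply: eq_integral => y _; apply: eq_integral => x _.
by rewrite /F/= normal_pdf_rotation.
Qed.

End rotation.

(** * Variance of the standard normal density *)

Section moments.
Context {R : realType}.
Notation lambda := (@lebesgue_measure R).
Local Notation phi := (@normal_pdf R 0 1).
Local Notation N01 := (@std_normal R).

Lemma std_normal_pdfE (x : R) :
  phi x = normal_peak 1 * expR (- (x ^+ 2 / 2)).
Proof. by rewrite normal_pdfE ?oner_eq0// /normal_fun subr0 expr1n mulNr. Qed.

Lemma is_derive_std_normal_pdf (x : R) : is_derive x 1 phi (- (x * phi x)).
Proof.
rewrite (_ : phi = fun y => normal_peak 1 * expR (- (y ^+ 2 / 2))); last first.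
  by apply/funext => y; exact: std_normal_pdfE.
apply: is_derive_eq.
by rewrite /GRing.scale/=; lra.
Qed.

(** From [1 + t <= expR t] at [t = x^2 / 2]. *)
Lemma std_normal_pdf_bound (x : R) : 0 < x -> x * phi x <= normal_peak 1 * (2 / x).
Proof.
move=> x0; rewrite std_normal_pdfE mulrCA ler_pM2l ?normal_peak_gt0 ?oner_eq0//.
rewrite expRN ler_pdivrMr ?expR_gt0// mulrAC ler_pdivlMr//.
have := expR_ge1Dx (x ^+ 2 / 2); lra.
Qed.

Lemma std_normal_pdf_tail : x * phi x @[x --> +oo] --> (0 : R).
Proof.
apply: (@squeeze_cvgr _ _ _ _ (cst 0) (fun x => normal_peak 1 * (2 / x))).
- near=> x; have x0 : 0 < x by near: x; exact: nbhs_pinfty_gt.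
  apply/andP; split; last exact: std_normal_pdf_bound.
  by rewrite /= mulr_ge0 ?normal_pdf_ge0 ?ltW.
- exact: cvg_cst.
- rewrite -[0 in X in _ --> X](mulr0 (normal_peak 1)).
  apply: cvgM; first exact: cvg_cst.
  rewrite -[0 in X in _ --> X](mulr0 2).
  apply: cvgM; first exact: cvg_cst.
  apply/gtr0_cvgV0; last exact: cvg_id.
  by near=> x; near: x; exact: nbhs_pinfty_gt.
Unshelve. all: by end_near. Qed.

Lemma is_derive_std_normal_pdfX (x : R) :
  is_derive x 1 (fun y => y * phi y) ((1 - x ^+ 2) * phi x).
Proof.
have ? := is_derive_std_normal_pdf x.
by apply: is_derive_eq; rewrite /GRing.scale/=; ring.
Qed.

Lemma continuous_std_normal_pdf : continuous phi.
Proof. by apply: continuous_normal_pdf; exact: oner_neq0. Qed.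

Lemma continuous_sqr_std_normal_pdf (a b : R) :
  continuous (fun x : R => (a + b * x ^+ 2) * phi x).
Proof.
move=> x; apply: cvgM; last exact: continuous_std_normal_pdf.
apply: cvgD; first exact: cvg_cst.
by apply: cvgM; [exact: cvg_cst|exact: sqr_continuous].
Qed.

Local Open Scope ereal_scope.

(** The antiderivative is [- x phi x], which vanishes at infinity. The cut at 1 is where [x^2 - 1]
    changes sign, so that the integrands on both sides of it are nonnegative. *)
Lemma integral_std_normal_pdf_1y :
  \int[lambda]_(x in `[1%R, +oo[) ((-1 + 1 * x ^+ 2) * phi x)%:E = (phi 1)%:E.
Proof.
rewrite (@ge0_continuous_FTC2y R _ (fun x => - (x * phi x))%R 1%R 0%R).
- by rewrite mul1r EFinN oppeK add0e.
- move=> x x1; rewrite mulr_ge0 ?normal_pdf_ge0// mul1r.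
  by rewrite addrC subr_ge0 expr_ge1// (le_trans _ x1).
- exact/continuous_subspaceT/continuous_sqr_std_normal_pdf.
- by rewrite -[0%R in X in _ --> X]oppr0; apply: cvgN; exact: std_normal_pdf_tail.
- move=> x _; have := is_derive_std_normal_pdfX x => ?.
  exact: derivableN.
- apply: cvg_at_right_filter; apply: cvgN.
  by apply: cvgM => //; exact: continuous_std_normal_pdf.
- move=> x _; have := is_derive_std_normal_pdfX x => ?.
  by rewrite derive1E deriveN// derive_val; ring.
Qed.

Lemma integral_std_normal_pdf_01 :
  \int[lambda]_(x in `[0%R, 1%R]) ((1 + -1 * x ^+ 2) * phi x)%:E = (phi 1)%:E.
Proof.
rewrite (@continuous_FTC2 R _ (fun x => x * phi x)%R).
- by rewrite mul1r mul0r sube0.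
- exact: ltr01.
- exact/continuous_subspaceT/continuous_sqr_std_normal_pdf.
- split.
  + by move=> x _; have := is_derive_std_normal_pdfX x => ?.
  + apply: cvg_at_right_filter.
    by apply: cvgM => //; exact: continuous_std_normal_pdf.
  + apply: cvg_at_left_filter.
    by apply: cvgM => //; exact: continuous_std_normal_pdf.
- move=> x _; have := is_derive_std_normal_pdfX x => ?.
  by rewrite derive1E derive_val mulN1r.
Qed.

(** By parity it suffices to compare [x^2 phi] with [phi] on the positive half-line. On [[0, 1]] the
    former integrates to [phi 1] less, beyond 1 to [phi 1] more, so both have total mass 1. All
    integrands are nonnegative, so integrability of [x^2 phi] need not be known beforehand. *)
Lemma integral_sqr_std_normal_pdf :
  \int[lambda]_x (x ^+ 2 * phi x)%:E = 1.
Proof.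
have mphi a b (D : set R) : measurable D ->
    measurable_fun D (fun x => ((a + b * x ^+ 2) * phi x)%:E : \bar R).
  move=> mD; apply/measurable_funTS/measurable_EFinP.
  by apply: continuous_measurable_fun; exact: continuous_sqr_std_normal_pdf.
have phi0 x : (0 <= phi x)%R by exact: normal_pdf_ge0.
have half (f : R -> R) : (forall x, 0 <= f x)%R -> continuous f ->
    f =1 f \o -%R -> \int[lambda]_x (f x)%:E =
    2%:E * (\int[lambda]_(x in `[0%R, 1%R]) (f x)%:E +
            \int[lambda]_(x in `[1%R, +oo[) (f x)%:E).
  move=> f0 cf ef; rewrite ge0_symfun_integralT//; congr (_ * _).
  have mf (D : set R) : measurable D -> measurable_fun D (fun x => (f x)%:E).
    move=> mD; apply/measurable_funTS/measurable_EFinP.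
    exact: continuous_measurable_fun.
  rewrite -[X in _ = _ + X]integral_itv_obnd_cbnd; last exact: mf.
  rewrite -ge0_integral_setU//=.
  - congr (integral _ _ _); apply/seteqP; split=> x /=; rewrite !in_itv/= ?andbT.
      by move=> x0; have [x1|x1] := lerP x 1%R; [left|right]; rewrite ?x0.
    by move=> [/andP[]//|/ltW x1]; exact: (le_trans ler01 x1).
  - apply: mf; exact: measurableU.
  - by move=> x _; rewrite lee_fin.
  - apply/disj_setPS => x [] /=; rewrite !in_itv/= andbT => /andP[_ x1].
    by rewrite ltNge x1.
transitivity (\int[lambda]_x (phi x)%:E); last exact: integral_normal_pdf.
rewrite (half (fun x => x ^+ 2 * phi x)%R); last 3 first.
- by move=> x; rewrite mulr_ge0 ?sqr_ge0.
- rewrite (_ : (fun x => _) = fun x => (0 + 1 * x ^+ 2) * phi x)%R.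
    exact: continuous_sqr_std_normal_pdf.
  by apply/funext => x; rewrite add0r mul1r.
- by move=> x /=; rewrite !std_normal_pdfE sqrrN.
rewrite (half phi)//; last 2 first.
- exact: continuous_std_normal_pdf.
- by move=> x /=; rewrite !std_normal_pdfE sqrrN.
congr (_ * _).
transitivity (\int[lambda]_(x in `[0%R, 1%R]) (x ^+ 2 * phi x)%:E + (phi 1)%:E +
    \int[lambda]_(x in `[1%R, +oo[) (phi x)%:E).
  rewrite -integral_std_normal_pdf_1y -addeA -ge0_integralD//=.
  - congr (_ + _); apply: eq_integral => x _; rewrite -EFinD; congr EFin; ring.
  - move=> x; rewrite in_itv/= andbT => x1; rewrite lee_fin mulr_ge0// mul1r.
    by rewrite addrC subr_ge0 expr_ge1// (le_trans _ x1).
  - exact: mphi.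
  - by move=> x _; rewrite lee_fin.
  - apply: (@eq_measurable_fun _ _ _ _ _ (fun x : R => ((1 + 0 * x ^+ 2) * phi x)%:E)).
      by move=> x _; rewrite mul0r addr0 mul1r.
    exact: mphi.
congr (_ + _).
rewrite -integral_std_normal_pdf_01 -ge0_integralD//=.
- by apply: eq_integral => x _; rewrite -EFinD; congr EFin; ring.
- by move=> x _; rewrite lee_fin mulr_ge0// sqr_ge0.
- apply: (@eq_measurable_fun _ _ _ _ _ (fun x : R => ((0 + 1 * x ^+ 2) * phi x)%:E)).
    by move=> x _; rewrite add0r mul1r.
  exact: mphi.
- move=> x; rewrite in_itv/= => /andP[x0 x1]; rewrite lee_fin mulr_ge0//.
  by rewrite mulN1r subr_ge0 expr_le1.
- exact: mphi.
Qed.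

End moments.

(** * Quantiles of the standard normal law *)

Section quantiles.
Context {R : realType}.
Notation lambda := (@lebesgue_measure R).
Local Notation phi := (@normal_pdf R 0 1).
Local Notation N01 := (@std_normal R).
Local Open Scope ereal_scope.

Lemma ge0_integral_std_normalN (f : R -> \bar R) :
  measurable_fun setT f -> (forall x, 0 <= f x) ->
  \int[N01]_x f (- x)%R = \int[N01]_x f x.
Proof.
move=> mf f0.
have mfN : measurable_fun setT (fun x : R => f (- x)%R) by exact: measurableT_comp.
have mphi : measurable_fun setT (fun x : R => (phi x)%:E : \bar R).
  by apply/measurable_EFinP; exact: measurable_normal_pdf.
have phi0 x : 0 <= (phi x)%:E by rewrite lee_fin normal_pdf_ge0.
rewrite !ge0_integral_std_normal//.
rewrite [RHS](@ge0_integral_affine _ (- 1)%R 0%R)//; first last.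
- by move=> x; exact: mule_ge0.
- exact: emeasurable_funM.
rewrite normrN1 mul1e; apply: eq_integral => x _.
by rewrite mulN1r addr0 !std_normal_pdfE sqrrN.
Qed.

Lemma std_normalN (A : set R) : measurable A -> N01 (-%R @^-1` A) = N01 A.
Proof.
move=> mA; have mNA : measurable (-%R @^-1` A).
  exact: measurable_preimage mA.
rewrite -[in LHS](setIT (-%R @^-1` A)) -[in RHS](setIT A) -!integral_indic//.
rewrite -[RHS]ge0_integral_std_normalN//; last first.
  by apply/measurable_EFinP; exact: measurable_indic.
Qed.

Lemma PhiE (z : R) : (Phi z)%:E = N01 `]-oo, z]%classic.
Proof. by rewrite /Phi fineK// -std_normalE fin_num_measure. Qed.

(** The two closed half-lines have equal mass by symmetry, cover the line and meet in a null set. *)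
Lemma Phi0 : (Phi 0 = 2^-1 :> R)%R.
Proof.
have N0 : N01 [set 0%R] = 0.
  have /null_content_dominatesP dom := @normal_prob_dominates R 0 1.
  by rewrite std_normalE; apply: dom => //; exact: lebesgue_measure_set1.
have NC : N01 `[0%R, +oo[%classic = N01 `]-oo, 0%R]%classic.
  rewrite -std_normalN//; congr (N01 _); apply/seteqP; split => x/=;
  by rewrite !in_itv/= andbT oppr_ge0.
have : N01 `]-oo, 0%R]%classic + N01 `[0%R, +oo[%classic - N01 [set 0%R] = 1.
  have I0 : `]-oo, 0%R]%classic `&` `[0%R, +oo[%classic = [set (0%R : R)].
    apply/seteqP; split => x /=; rewrite !in_itv/= andbT.
      by move=> [x0 x1]; apply/eqP; rewrite eq_le x0.
    by move=> ->.
  rewrite -I0 -[RHS](probability_setT N01) -measureUfinr//; last first.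
    by rewrite -ge0_fin_numE// fin_num_measure.
  congr (N01 _); rewrite -subTset => x _ /=; rewrite !in_itv/= andbT.
  by have [|/ltW] := lerP x 0%R; [left|right].
rewrite N0 sube0 NC -PhiE -EFinD => -[]; lra.
Qed.

Lemma Phi_itv (a b : R) : (a <= b)%R -> (Phi b)%:E = (Phi a)%:E + N01 `]a, b]%classic.
Proof.
move=> ab; rewrite !PhiE -measureU//.
  congr (N01 _); apply/seteqP; split => x /=; rewrite !in_itv/=.
    by move=> xb; have [|ax] := lerP x a; [left|right].
  by move=> [xa|/andP[]//]; exact: le_trans xa ab.
apply/seteqP; split => x //=; rewrite !in_itv/= => -[xa /andP[]].
by rewrite ltNge xa.
Qed.

Lemma Phi_nondecreasing (a b : R) : (a <= b -> Phi a <= Phi b)%R.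
Proof. by move=> ab; rewrite -lee_fin (Phi_itv ab) leeDl. Qed.

(** The mass of []z, 0]] is at least its length times [phi z], the least value of the density
    there. *)
Lemma Phi_increasing0 (z : R) : (z < 0 -> Phi z < Phi 0)%R.
Proof.
move=> z0; rewrite -lte_fin (Phi_itv (ltW z0)) lteDl// std_normalE.
have phi_ge x : x \in `]z, 0%R] -> (phi z <= phi x)%R.
  rewrite in_itv/= => /andP[zx x0]; rewrite !std_normal_pdfE.
  rewrite ler_pM2l ?normal_peak_gt0 ?oner_eq0// ler_expR lerN2 ler_pM2r//.
  rewrite -(sqrrN x) -(sqrrN z) ler_pXn2r ?nnegrE ?oppr_ge0// ?ltW//.
  by rewrite ltrN2.
apply: (@lt_le_trans _ _ (\int[lambda]_(x in `]z, 0%R]) (phi z)%:E)).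
  rewrite integral_cst//= lebesgue_measure_itv/= lte_fin z0 -EFinB -EFinM sub0r.
  rewrite lte_fin mulr_gt0 ?oppr_gt0// std_normal_pdfE.
  by rewrite mulr_gt0 ?expR_gt0// normal_peak_gt0 ?oner_eq0.
apply: ge0_le_integral => //.
- by move=> x _; rewrite lee_fin normal_pdf_ge0.
- by apply/measurable_funTS/measurable_EFinP; exact: measurable_normal_pdf.
Qed.

(** Intermediate values on [[0, b]]: the lower end has value [1/2], [b] comes from the limit 1 of
    the distribution function, and [Phi] is continuous there as an indefinite integral. *)
Lemma Phi_surj (q : R) : (2^-1 <= q < 1 -> exists z, Phi z = q)%R.
Proof.
move=> /andP[q2 q1].
pose X : {RV N01 >-> R} := mfun_of (@measurable_id _ R setT).
have [b b0 qb] : exists2 b : R, (0 <= b)%R & (q <= Phi b)%R.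
  have qX : \forall r \near +oo%R, q%:E < cdf X r.
    exact: (cvg_cdfy1 X (@nbhs_open_ereal_gt _ 1%R (cst q) q1)).
  have [r [/ltW qr r0]] : exists r, q%:E < cdf X r /\ (0 <= r)%R.
    apply: (@filter_ex _ +oo%R); near=> r; split.
      by near: r; exact: qX.
    by near: r; exact: nbhs_pinfty_ge.
  by exists r => //; rewrite -lee_fin PhiE.
have cPhi : {within `[0%R, b], continuous (@Phi R)}.
  have intphi : lambda.-integrable `[0%R, b] (EFin \o phi).
    by apply: integrableS (@integrable_normal_pdf R 0 1).
  apply: (@subspace_eq_continuous _ _ _
    (fun x => Phi 0 + parameterized_integral lambda 0 x phi)%R).
    move=> x; rewrite inE/= in_itv/= => /andP[x0 xb]; apply: EFin_inj.
    rewrite (Phi_itv x0) EFinD; congr (_ + _).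
    rewrite /parameterized_integral /Rintegral fineK; last first.
      apply: integrable_fin_num => //; apply: integrableS intphi => //.
      by apply: subset_itvl; rewrite bnd_simp.
    rewrite std_normalE /normal_prob; apply/esym/integral_itv_obnd_cbnd.
    by apply/measurable_funTS/measurable_EFinP; exact: measurable_normal_pdf.
  have := parameterized_integral_continuous b0 intphi.
  move=> cI x; apply: cvgD; first exact: cvg_cst.
  exact: cI.
have [|z _ zq] := @IVT R (@Phi R) 0%R b q b0 cPhi; last by exists z.
by have := Phi_nondecreasing b0; rewrite Phi0 minEle maxEle => ->; rewrite q2.
Unshelve. all: by end_near. Qed.

Lemma Phi_invK (q : R) : (2^-1 <= q < 1 -> Phi (Phi_inv q) = q)%R.
Proof.
move=> /Phi_surj[z zq]; rewrite /Phi_inv pinvK//.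
by rewrite inE; exists z.
Qed.

Lemma Phi_inv_ge0 (q : R) : (2^-1 <= q < 1 -> 0 <= Phi_inv q)%R.
Proof.
move=> q21; rewrite leNgt; apply/negP => /Phi_increasing0.
by rewrite Phi_invK// Phi0 ltNge; case/andP: q21 => ->.
Qed.

End quantiles.

(** * Standard normal vectors *)

Section standard_vectors.
Context {R : realType}.
Local Notation N01 := (@std_normal R).
Local Open Scope ereal_scope.

Lemma product_probability_fst d1 d2 (T1 : measurableType d1)
    (T2 : measurableType d2) (P1 : probability T1 R) (P2 : probability T2 R)
    (A : set T1) :
  measurable A -> (P1 \x P2) (fst @^-1` A) = P1 A.
Proof.
move=> mA; rewrite (_ : fst @^-1` A = A `*` setT).
  by rewrite product_measure1E// [X in _ * X]probability_setT mule1.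
by apply/seteqP; split => -[x y]// [].
Qed.

Lemma product_probability_snd d1 d2 (T1 : measurableType d1)
    (T2 : measurableType d2) (P1 : probability T1 R) (P2 : probability T2 R)
    (A : set T2) :
  measurable A -> (P1 \x P2) (snd @^-1` A) = P2 A.
Proof.
move=> mA; rewrite (_ : snd @^-1` A = setT `*` A).
  by rewrite product_measure1E// [X in X * _]probability_setT mul1e.
by apply/seteqP; split => -[x y]// [].
Qed.

Lemma indep_product d1 d2 (T1 : measurableType d1)
    (T2 : measurableType d2) (P1 : probability T1 R) (P2 : probability T2 R) :
  indep_pair (P1 \x P2) fst snd.
Proof.
move=> A B mA mB; transitivity (P1 A * P2 B); first exact: product_measure1E.
congr (_ * _); apply/esym; first exact: product_probability_fst.
exact: product_probability_snd.
Qed.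

(** By independence the law of the pair is the product measure, whose rotation invariance is applied
    to the indicator of a rectangle. *)
Lemma indep_std_normal_rotation d (T : measurableType d) (P : probability T R)
    (X Y : T -> R) (c s : R) (A B : set R) :
  measurable_fun setT X -> measurable_fun setT Y -> indep_pair P X Y ->
  same_law P N01 X id -> same_law P N01 Y id ->
  (c ^+ 2 + s ^+ 2 = 1)%R -> measurable A -> measurable B ->
  P ((fun o => (X o, Y o)) @^-1`
     [set z | A (c * z.1 + s * z.2)%R /\ B (c * z.2 - s * z.1)%R]) =
  N01 A * N01 B.
Proof.
move=> mX mY XY lX lY cs1 mA mB.
pose rot (z : R * R) := (c * z.1 + s * z.2, c * z.2 - s * z.1)%R.
have mrot : measurable_fun setT rot.
  apply: measurable_fun_pair; first exact: measurable_linear2.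
  rewrite (_ : (fun z : R * R => _) = fun z => (- s * z.1 + c * z.2)%R).
    exact: measurable_linear2.
  by apply/funext => z; rewrite mulNr (addrC (- _)%R).
have mAB : measurable (A `*` B) by exact: measurableX.
have mW : measurable (rot @^-1` (A `*` B)) by exact: measurable_preimage.
have lXY : same_law P (N01 \x N01) (fun o => (X o, Y o)) (fun z => (z.1, z.2)).
  apply: same_law_pair => //.
  - exact: indep_product.
  - by move=> C mC; rewrite lX//; apply/esym; exact: product_probability_fst.
  - by move=> C mC; rewrite lY//; apply/esym; exact: product_probability_snd.
rewrite (_ : [set z | _] = rot @^-1` (A `*` B))// lXY//.
rewrite (_ : (fun z : R * R => (z.1, z.2)) = id); last first.
  by apply/funext; case.
rewrite preimage_id.
have indicE (C : set (R * R)) : measurable C ->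
    (N01 \x N01) C = \int[N01 \x N01]_z (\1_C z)%:E.
  by move=> mC; rewrite -[in LHS](setIT C); apply/esym; exact: integral_indic.
apply: (etrans (indicE _ mW)).
pose F (z : R * R) : \bar R := (\1_(A `*` B) z : R)%:E.
have mF : measurable_fun setT F.
  by apply/measurable_EFinP; exact: measurable_indic.
have F0 (z : R * R) : 0 <= F z by rewrite lee_fin.
transitivity (\int[N01 \x N01]_z F (rot z)); first exact: eq_integral.
apply: (etrans (ge0_normal_rotation cs1 mF F0)).
apply: (etrans (esym (indicE _ mAB))).
exact: product_measure1E.
Qed.

Definition entry (T : Type) n (Z : T -> 'cV[R]_n) (i : 'I_n) (o : T) : R := Z o i 0%R.

(** Independence concerns all sublists of coordinates; a single formula over all of them suffices,
    since coordinates left out can be given the event [setT]. *)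
Lemma standard_normalP d (T : measurableType d) (P : probability T R) n
    (Z : T -> 'cV[R]_n) : measurable_fun setT Z ->
  standard_normal P Z <->
  forall U : 'I_n -> set R, (forall i, measurable (U i)) ->
    P (\big[setI/setT]_i (entry Z i @^-1` U i)) = \prod_i N01 (U i).
Proof.
move=> mZ; split.
  move=> [ZN ZI] U mU.
  rewrite (mutually_independentE ZI) ?index_enum_uniq//.
    by apply: eq_bigr => i _; exact: (ZN i _ (mU i)).
  by move=> i _; exists (U i) => //; rewrite setTI.
move=> ZU.
have ZN i (U : set R) : measurable U -> P (entry Z i @^-1` U) = N01 U.
  move=> mU; have := ZU (fun k => if k == i then U else setT).
  rewrite (bigD1 i)//= big1 ?setIT; last first.
    by move=> k /negbTE ->; rewrite preimage_setT.
  rewrite [in RHS](bigD1 i)//= [in RHS]big1 ?mule1 ?eqxx; last first.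
    by move=> k /negbTE ->; rewrite probability_setT.
  by rewrite ?eqxx; apply => k; case: ifP.
split; first exact: ZN.
move=> J E uJ ZE; rewrite bigcap_seqE.
have /boolp.choice[V VE] : forall j, exists Vj : set R, j \in J ->
    measurable Vj /\ entry Z j @^-1` Vj = E j.
  move=> j.
  have [jJ|jJ] := boolP (j \in J); last by exists setT.
  by have [U mU <-] := ZE _ jJ; exists U => _; rewrite setTI.
pose U j := if j \in J then V j else setT.
have mU j : measurable (U j) by rewrite /U; case: ifPn => // /VE[].
have := ZU U mU.
rewrite (bigID (mem J))/= [X in _ `&` X]big1 ?setIT; last first.
  by move=> j /negbTE jJ; rewrite /U jJ preimage_setT.
rewrite [in RHS](bigID (mem J))/= [X in _ = _ * X -> _]big1 ?mule1; last first.
  by move=> j /negbTE jJ; rewrite /U jJ probability_setT.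
rewrite -!big_uniq//= => H.
transitivity (P (\big[setI/setT]_(i <- J) (entry Z i @^-1` U i))).
  by congr (P _); apply: eq_big_seq => j jJ; rewrite /U jJ; have [_ ->] := VE j jJ.
rewrite H; apply: eq_big_seq => j jJ; rewrite /U jJ.
by have [mV <-] := VE j jJ; rewrite ZN.
Qed.

End standard_vectors.

(** * Plane rotations of standard normal vectors *)

Section givens.
Context {R : realType}.
Local Notation N01 := (@std_normal R).

(** A map on columns rather than an orthogonal matrix: it acts on the random vector and, after
    transposition, on the rows of [L]. *)
Definition givens n (c s : R) (i j : 'I_n) (z : 'cV[R]_n) : 'cV[R]_n :=
  \col_k if k == i then c * z i 0 + s * z j 0
         else if k == j then c * z j 0 - s * z i 0 else z k 0.

Lemma measurable_coord d (T : measurableType d) n (Z : T -> 'cV[R]_n) i :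
  measurable_fun setT Z -> measurable_fun setT (entry Z i).
Proof. exact: measurable_entry. Qed.

Lemma measurable_givens n c s (i j : 'I_n) : measurable_fun setT (givens c s i j).
Proof.
have mz k : measurable_fun setT (fun z : 'cV[R]_n => z k 0).
  exact: measurable_mx_entry.
apply: measurable_mxP => k l.
have [ki|ki] := boolP (k == i).
  under eq_fun do rewrite mxE ki.
  by apply: measurable_funD; exact: measurable_funM.
have [kj|kj] := boolP (k == j).
  under eq_fun do rewrite mxE (negbTE ki) kj.
  by apply: measurable_funB; exact: measurable_funM.
under eq_fun do rewrite mxE (negbTE ki) (negbTE kj).
exact: mz.
Qed.

Local Open Scope ereal_scope.

Lemma standard_normal_indep_pair d (T : measurableType d) (P : probability T R) n
    (Z : T -> 'cV[R]_n) (i j : 'I_n) :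
  standard_normal P Z -> i != j -> indep_pair P (entry Z i) (entry Z j).
Proof.
move=> [_ ZI] ij A B mA mB.
pose E k := if k == i then entry Z i @^-1` A else entry Z j @^-1` B.
have := mutually_independentE ZI (J := [:: i; j]) (E := E).
rewrite !big_cons !big_nil setIT mule1 /E eqxx eq_sym (negbTE ij); apply.
  by rewrite /= inE ij.
move=> k; rewrite !inE => /orP[|] /eqP ->.
  by rewrite eqxx; exists A; rewrite ?setTI.
by rewrite eq_sym (negbTE ij); exists B; rewrite ?setTI.
Qed.

Lemma standard_normal_entry d (T : measurableType d) (P : probability T R) n
    (Z : T -> 'cV[R]_n) (i : 'I_n) :
  standard_normal P Z -> same_law P N01 (entry Z i) id.
Proof. by move=> [ZN _] U mU; exact: ZN. Qed.

(** The rotated pair keeps its law and stays independent of the other coordinates, whose events are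
    gathered in [G]. *)
Lemma standard_normal_givens d (T : measurableType d) (P : probability T R) n
    (Z : T -> 'cV[R]_n) c s (i j : 'I_n) :
  measurable_fun setT Z -> i != j -> (c ^+ 2 + s ^+ 2 = 1)%R ->
  standard_normal P Z -> standard_normal P (fun o => givens c s i j (Z o)).
Proof.
move=> mZ ij cs1 ZN.
have /(standard_normalP P mZ) ZU := ZN.
have ji : j != i by rewrite eq_sym.
have mgZ : measurable_fun setT (fun o => givens c s i j (Z o)).
  by apply: (measurableT_comp _ mZ); exact: measurable_givens.
apply/standard_normalP => // U mU.
pose G := \big[setI/setT]_(k | (k != i) && (k != j)) (entry Z k @^-1` U k).
pose pG := \prod_(k | (k != i) && (k != j)) N01 (U k).
have mG : measurable G.
  apply: bigsetI_measurable => k _; apply: measurable_preimage => //.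
  exact: measurable_coord.
have PABG A B : measurable A -> measurable B ->
    P (entry Z i @^-1` A `&` entry Z j @^-1` B `&` G) = N01 A * N01 B * pG.
  move=> mA mB.
  have := ZU (fun k => if k == i then A else if k == j then B else U k).
  rewrite (bigD1 i)//= (bigD1 j)//= [in RHS](bigD1 i)//= [in RHS](bigD1 j)//=.
  rewrite !eqxx (negbTE ji).
  under eq_bigr => k /andP[/negbTE -> /negbTE ->] do rewrite -/(entry Z).
  under [in RHS]eq_bigr => k /andP[/negbTE -> /negbTE ->] do [].
  rewrite -/G setIA muleA; apply => k.
  by case: ifP => // _; case: ifP.
have PG : P G = pG.
  have := PABG _ _ measurableT measurableT.
  by rewrite !preimage_setT !setTI probability_setT !mul1e.
have mi := measurable_coord i mZ; have mj := measurable_coord j mZ.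
have Iij := standard_normal_indep_pair ZN ij.
rewrite (bigD1 i)//= (bigD1 j)//= [in RHS](bigD1 i)//= [in RHS](bigD1 j)//=.
have -> : \big[setI/setT]_(k | (k != i) && (k != j))
    (entry (fun o => givens c s i j (Z o)) k @^-1` U k) = G.
  apply: eq_bigr => k /andP[ki kj]; rewrite /entry/=.
  by apply/seteqP; split => o /=; rewrite mxE (negbTE ki) (negbTE kj).
rewrite muleA -/pG.
rewrite -(indep_std_normal_rotation mi mj Iij (standard_normal_entry _ ZN)
  (standard_normal_entry _ ZN) cs1 (mU i) (mU j)) -PG.
rewrite -indep_event_pair//.
- congr (P _); rewrite setIA; congr (_ `&` _).
  apply/seteqP; split => o /=; rewrite /entry/= !mxE !eqxx (negbTE ji) /=;
  exact.
- move=> A B mA mB; rewrite PABG// PG; congr (_ * _ * _).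
  + by apply/esym; exact: (standard_normal_entry i ZN mA).
  + by apply/esym; exact: (standard_normal_entry j ZN mB).
- set g := (fun z : R * R => c * z.1 + s * z.2)%R.
  set h := (fun z : R * R => c * z.2 - s * z.1)%R.
  apply: (@measurableI _ _ (g @^-1` U i) (h @^-1` U j)).
    by apply: measurable_preimage => //; exact: measurable_linear2.
  apply: measurable_preimage => //.
  rewrite (_ : h = fun z => (- s * z.1 + c * z.2)%R).
    exact: measurable_linear2.
  by apply/funext => z; rewrite mulNr (addrC (- _)%R).
Qed.

End givens.

Section reduction.
Context {R : realType}.
Local Notation N01 := (@std_normal R).

(** Orthogonality. For a row of [L] and [Z] it preserves [L Z]; for two rows of [L] it preserves
    [L L^T]. *)
Lemma givens_dot n c s (i j : 'I_n) (x y : 'cV[R]_n) :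
  i != j -> c ^+ 2 + s ^+ 2 = 1 ->
  \sum_k givens c s i j x k 0 * givens c s i j y k 0 = \sum_k x k 0 * y k 0.
Proof.
move=> ij cs1; have ji : j != i by rewrite eq_sym.
rewrite (bigD1 i)//= (bigD1 j)//= [in RHS](bigD1 i)//= [in RHS](bigD1 j)//=.
rewrite !addrA; congr (_ + _); last first.
  apply: eq_bigr => k /andP[/negbTE ki /negbTE kj].
  by rewrite !mxE ki kj.
rewrite !mxE !eqxx (negbTE ji).
transitivity ((c ^+ 2 + s ^+ 2) * (x i 0 * y i 0 + x j 0 * y j 0)); first by ring.
by rewrite cs1 mul1r.
Qed.

(* Rotations in the planes spanned by the coordinates 0 and j clear the row [i]
   of [L] outside its first entry; they are absorbed by the law of [Z]. *)
Lemma givens_reduction d (T : measurableType d) (P : probability T R) n m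
    (L : 'M[R]_(n, m.+1)) (i : 'I_n) (Z : T -> 'cV[R]_m.+1) :
  measurable_fun setT Z -> standard_normal P Z ->
  exists (L' : 'M[R]_(n, m.+1)) (Z' : T -> 'cV[R]_m.+1),
    [/\ measurable_fun setT Z', standard_normal P Z',
        forall o, L' *m Z' o = L *m Z o, L' *m L'^T = L *m L^T &
        forall j, j != 0 -> L' i j = 0].
Proof.
move=> mZ ZN.
(* [k] counts the columns already cleared in row [i]. *)
suff H (k : nat) : (k <= m)%N ->
  exists (L' : 'M[R]_(n, m.+1)) (Z' : T -> 'cV[R]_m.+1),
    [/\ measurable_fun setT Z', standard_normal P Z',
        forall o, L' *m Z' o = L *m Z o, L' *m L'^T = L *m L^T &
        forall j : 'I_m.+1, (0 < j <= k)%N -> L' i j = 0].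
  have [L' [Z' [mZ' ZN' LZ LL L0]]] := H m (leqnn m).
  by exists L', Z'; split => // j j0; rewrite L0// lt0n j0/= -ltnS.
elim: k => [_|k IHk km].
  by exists L, Z; split => // j; rewrite leqn0 lt0n andNb.
have [L' [Z' [mZ' ZN' LZ LL L0]]] := IHk (ltnW km).
pose j : 'I_m.+1 := Ordinal (n := m.+1) (m := k.+1) km.
have j0 : 0 != j by [].
pose a := L' i 0; pose b := L' i j.
(* A zero entry needs no rotation; otherwise the radius [r] below is nonzero. *)
have [b0|b0] := eqVneq b 0.
  exists L', Z'; split => // l /andP[l0].
  rewrite leq_eqVlt => /orP[/eqP lk|lk]; last by rewrite L0// l0.
  by rewrite (_ : l = j)//; exact: val_inj.
have ab0 : 0 < a ^+ 2 + b ^+ 2.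
  by rewrite ltr_wpDl ?sqr_ge0// exprn_even_gt0.
pose r := Num.sqrt (a ^+ 2 + b ^+ 2).
have r0 : r != 0 by rewrite gt_eqF// sqrtr_gt0.
have r2 : r ^+ 2 = a ^+ 2 + b ^+ 2 by rewrite sqr_sqrtr// ltW.
(* This angle sends [(a, b)] to [(r, 0)]. *)
pose c := a / r; pose s := b / r.
have cs1 : c ^+ 2 + s ^+ 2 = 1.
  by rewrite /c /s !expr_div_n -mulrDl -r2 divff// expf_neq0.
pose L'' := \matrix_(p < n, q < m.+1) givens c s 0 j (row p L')^T q 0.
exists L'', (fun o => givens c s 0 j (Z' o)); split.
- by apply: (measurableT_comp _ mZ'); exact: measurable_givens.
- exact: standard_normal_givens.
- move=> o; rewrite -LZ; apply/colP => p; rewrite !mxE.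
  transitivity (\sum_k givens c s 0 j (row p L')^T k 0 *
                        givens c s 0 j (Z' o) k 0).
    by apply: eq_bigr => q _; rewrite mxE.
  by rewrite givens_dot//; apply: eq_bigr => q _; rewrite !mxE.
- rewrite -LL; apply/matrixP => p q; rewrite !mxE.
  transitivity (\sum_k givens c s 0 j (row p L')^T k 0 *
                        givens c s 0 j (row q L')^T k 0).
    by apply: eq_bigr => l _; rewrite [X in X * _]mxE [X in _ * X]mxE [X in _ * X]mxE.
  by rewrite givens_dot//; apply: eq_bigr => l _; rewrite !mxE.
- move=> l /andP[l0]; rewrite !mxE -val_eqE/= (gtn_eqF l0).
  rewrite leq_eqVlt => /orP[/eqP lk|lk].
    rewrite (_ : l = j); last exact: val_inj.
    by rewrite eqxx -/a -/b /c /s; field.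
  rewrite ifF; last by apply/negbTE; rewrite -val_eqE/= neq_ltn lk.
  by rewrite L0// l0.
Qed.

End reduction.

(** * Linear images of standard normal vectors are determined by [L L^T] *)

Section uniqueness.
Context {R : realType}.
Local Notation N01 := (@std_normal R).

Definition box n (U : 'I_n -> set R) : set 'cV[R]_n :=
  [set z | forall i, U i (z i 0)].

Lemma preimage_box T n (Z : T -> 'cV[R]_n) (U : 'I_n -> set R) :
  Z @^-1` box U = \big[setI/setT]_i (entry Z i @^-1` U i).
Proof.
rewrite -bigcap_seqE; apply/seteqP; split => o /= ZU.
  by move=> i _; exact: ZU.
by move=> i; apply: (ZU i); rewrite /= mem_index_enum.
Qed.

(** A generating family stable under intersection, which the one-entry cylinders of [mx_cylinder]
    are not in general. *)
Definition boxes n : set (set 'cV[R]_n) :=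
  [set box U | U in [set U : 'I_n -> set R | forall i, measurable (U i)]].

Lemma measurable_boxes n : @measurable _ 'cV[R]_n = <<s @boxes n >>.
Proof.
apply/seteqP; split.
  apply: smallest_sub; first exact: smallest_sigma_algebra.
  move=> _ [[i j] _ [U mU <-]]; apply: sub_sigma_algebra.
  exists (fun k => if k == i then U else setT).
    by move=> k /=; case: ifP.
  rewrite setTI; apply/seteqP; split => z /=.
    by move=> /(_ i); rewrite eqxx ord1.
  by move=> Uz k; case: eqP => // ->; rewrite ord1 in Uz.
apply: smallest_sub; first exact: sigma_algebra_measurable.
move=> _ [U mU <-]; rewrite -[box U]preimage_id preimage_box.
apply: bigsetI_measurable => i _; apply: measurable_preimage => //.
exact: measurable_mx_entry.
Qed.

Lemma setI_closed_boxes n : setI_closed (@boxes n).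
Proof.
move=> _ _ [U mU <-] [V mV <-]; exists (fun i => U i `&` V i).
  by move=> i; exact: measurableI.
apply/seteqP; split => z /=; first by move=> UV; split => i; case: (UV i).
by move=> [Uz Vz] i; split; [exact: Uz|exact: Vz].
Qed.

Lemma boxes_setT n : boxes (setT : set 'cV[R]_n).
Proof. by exists (fun=> setT) => //; apply/seteqP; split. Qed.

Local Open Scope ereal_scope.

Lemma standard_normal_split d (T : measurableType d) (P : probability T R) n
    (Z : T -> 'cV[R]_(1 + n)) :
  measurable_fun setT Z -> standard_normal P Z ->
  standard_normal P (fun o => dsubmx (Z o)) /\
  indep_pair P (entry Z 0%R) (fun o => dsubmx (Z o)).
Proof.
move=> mZ ZN; have /(standard_normalP P mZ) ZU := ZN.
have mdZ : measurable_fun setT (fun o => dsubmx (Z o)).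
  apply: measurable_mxP => i j; under eq_fun do rewrite mxE.
  exact: measurable_entry.
have PAU A (U : 'I_n -> set R) : measurable A -> (forall i, measurable (U i)) ->
    P (entry Z 0%R @^-1` A `&`
       \big[setI/setT]_i (entry (fun o => dsubmx (Z o)) i @^-1` U i)) =
    N01 A * \prod_i N01 (U i).
  move=> mA mU.
  pose V (i : 'I_(1 + n)) := if fintype.split i is inr k then U k else A.
  have VA : V 0%R = A.
    by rewrite /V; case: splitP.
  have VU i : V (lift ord0 i) = U i.
    rewrite (_ : lift ord0 i = rshift 1 i); last exact: val_inj.
    by rewrite /V (unsplitK (inr i : 'I_1 + 'I_n)%type).
  have := ZU V; rewrite big_ord_recl [in RHS]big_ord_recl VA.
  under [in RHS]eq_bigr do rewrite VU.
  move=> <-; last by move=> i; rewrite /V; case: splitP.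
  congr (P (_ `&` _)); apply: eq_bigr => i _; rewrite VU.
  apply/seteqP; split => o /=; rewrite /entry mxE;
  by rewrite (_ : lift ord0 i = rshift 1 i)//; exact: val_inj.
split.
  apply/standard_normalP => // U mU.
  have := PAU setT U measurableT mU.
  by rewrite preimage_setT setTI probability_setT mul1e.
move=> A B mA mB; rewrite setIC muleC.
apply: (indep_event_generated (measurable_boxes n) (@setI_closed_boxes n)
  (@boxes_setT n) mdZ) => //.
  by apply: measurable_preimage => //; exact: measurable_entry.
move=> _ [U mU <-]; rewrite preimage_box setIC PAU// muleC.
rewrite (standard_normal_entry 0%R ZN mA); congr (_ * _).
have := PAU setT U measurableT mU.
by rewrite preimage_setT setTI probability_setT mul1e => ->.
Qed.

Lemma same_law_sign d (T : measurableType d) (P : probability T R) (X : T -> R)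
    (b : bool) :
  same_law P N01 X id -> same_law P N01 (fun o => (-1) ^+ b * X o)%R id.
Proof.
move=> XN; case: b => U mU; rewrite ?expr1 ?expr0; last first.
  by under eq_fun do rewrite mul1r; exact: XN.
under eq_fun do rewrite mulN1r.
rewrite preimage_id -std_normalN//.
apply: (XN (-%R @^-1` U)); exact: measurable_preimage mU.
Qed.

Lemma same_law_trans d1 d2 d3 d (T1 : measurableType d1)
    (T2 : measurableType d2) (T3 : measurableType d3) (S : measurableType d)
    (P1 : probability T1 R) (P2 : probability T2 R) (P3 : probability T3 R)
    (X1 : T1 -> S) (X2 : T2 -> S) (X3 : T3 -> S) :
  same_law P1 P2 X1 X2 -> same_law P2 P3 X2 X3 -> same_law P1 P3 X1 X3.
Proof. by move=> X12 X23 U mU; rewrite X12// X23. Qed.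

Lemma same_law_sym d1 d2 d (T1 : measurableType d1)
    (T2 : measurableType d2) (S : measurableType d)
    (P1 : probability T1 R) (P2 : probability T2 R)
    (X1 : T1 -> S) (X2 : T2 -> S) :
  same_law P1 P2 X1 X2 -> same_law P2 P1 X2 X1.
Proof. by move=> X12 U mU; rewrite X12. Qed.

End uniqueness.

Section uniqueness.
Context {R : realType}.
Local Notation N01 := (@std_normal R).

Lemma measurable_linear_rv d (T : measurableType d) n m (L : 'M[R]_(n, m))
    (Z : T -> 'cV[R]_m) :
  measurable_fun setT Z -> measurable_fun setT (fun o => L *m Z o).
Proof. by move=> mZ; exact: measurable_mulmx. Qed.

Lemma mulmx_trmx_eq0 m (v : 'rV[R]_m) : v *m v^T = 0 -> v = 0.
Proof.
move=> /matrixP/(_ 0 0); rewrite !mxE => v0.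
have {}v0 : \sum_k v 0 k ^+ 2 = 0.
  by rewrite -[RHS]v0; apply: eq_bigr => k _; rewrite mxE expr2.
apply/rowP => k; rewrite mxE.
have /psumr_eq0P : forall i, true -> 0 <= v 0 i ^+ 2 by move=> i _; exact: sqr_ge0.
by move=> /(_ v0 k isT)/eqP; rewrite sqrf_eq0 => /eqP.
Qed.

(** After the rotations only one coordinate enters the first row. The block form of [L L^T] then
    shows what it retains: [l] and [g] are read off its first column, and only [M M^T], with one row
    less, remains. *)
Lemma standard_normal_pivot d (T : measurableType d) (P : probability T R) n m
    (L : 'M[R]_(1 + n, m)) (Z : T -> 'cV[R]_m) :
  measurable_fun setT Z -> standard_normal P Z -> usubmx L != 0 ->
  exists (m' : nat) (l : R) (g : 'cV[R]_n) (M : 'M[R]_(n, m')) (X : T -> R)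
      (Y : T -> 'cV[R]_m'),
    [/\ [/\ 0 < l, measurable_fun setT X & measurable_fun setT Y],
        same_law P N01 X id, standard_normal P Y, indep_pair P X Y &
        (forall o, L *m Z o = col_mx (l * X o)%:M (X o *: g + M *m Y o)) /\
        L *m L^T = block_mx (l ^+ 2)%:M (l *: g^T) (l *: g) (g *m g^T + M *m M^T)].
Proof.
case: m L Z => [|m] L Z mZ ZN L0.
  by rewrite (thinmx0 (usubmx L)) eqxx in L0.
have [L' [Z' [mZ' ZN' LZ LL L'0]]] := givens_reduction L (0 : 'I_(1 + n)) mZ ZN.
(* The sign makes the pivot positive; it is also moved onto [X], whose law is symmetric. *)
pose l' := L' 0 0; pose b := l' < 0.
have [YN XY] := standard_normal_split (n := m) mZ' ZN'.
pose l := (-1) ^+ b * l'; pose g := (-1) ^+ b *: dlsubmx (L' : 'M[R]_(1 + n, 1 + m)).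
pose M := drsubmx (L' : 'M[R]_(1 + n, 1 + m)).
have L'E : L' = @block_mx _ 1 n 1 m l'%:M 0 (dlsubmx (L' : 'M[R]_(1 + n, 1 + m))) M.
  rewrite -[LHS](@submxK _ 1 n 1 m).
  have -> : ulsubmx (L' : 'M[R]_(1 + n, 1 + m)) = l'%:M.
    apply/matrixP => i j; rewrite !ord1 !mxE eqxx /l' mulr1n.
    by congr (L' _ _); exact: val_inj.
  have -> : ursubmx (L' : 'M[R]_(1 + n, 1 + m)) = 0.
    apply/matrixP => i j; rewrite !ord1 !mxE (_ : lshift n 0 = 0) ?L'0//.
    exact: val_inj.
  by [].
(* [L'] in block form, so that the block lemmas see its width as [1 + m] instead of [m.+1]. *)
pose LB := @block_mx _ 1 n 1 m l'%:M 0 (dlsubmx (L' : 'M[R]_(1 + n, 1 + m))) M.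
have LLB : LB *m LB^T = L *m L^T by rewrite -LL; congr (_ *m _^T); exact: esym.
have LZB o : LB *m (Z' o : 'cV[R]_(1 + m)) = L *m Z o.
  by rewrite -LZ; congr (_ *m _); exact: esym.
have LLs : L *m L^T = block_mx (usubmx L *m (usubmx L)^T)
    (usubmx L *m (dsubmx L)^T) (dsubmx L *m (usubmx L)^T)
    (dsubmx L *m (dsubmx L)^T).
  by rewrite -mul_col_row -tr_col_mx vsubmxK.
have bb : (-1) ^+ b * (-1) ^+ b = 1 :> R by rewrite -signr_addb addbb.
(* [l'^2] is the squared norm of the first row of [L]. *)
have l'0 : l' != 0.
  apply: contraNneq L0 => l'0.
  have : usubmx L *m (usubmx L)^T = 0.
    have := LLB; rewrite LLs /LB l'0 tr_block_mx mulmx_block => /eq_block_mx[<- _ _ _].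
    by rewrite !trmx0 raddf0 !mul0mx addr0.
  by move/mulmx_trmx_eq0 ->.
have l0 : 0 < l.
  rewrite /l /b; have [l'n|] := ltrP l' 0.
    by rewrite expr1 mulN1r oppr_gt0.
  by rewrite le_eqVlt eq_sym (negbTE l'0) expr0 mul1r.
have mX : measurable_fun setT (fun o => (-1) ^+ b * entry Z' 0 o).
  by apply: measurable_funM => //; exact: measurable_entry.
have mY : measurable_fun setT (fun o => dsubmx (Z' o : 'cV_(1 + m))).
  apply: measurable_mxP => i j; under eq_fun do rewrite mxE.
  exact: measurable_entry.
exists m, l, g, M, (fun o => (-1) ^+ b * entry Z' 0 o), (fun o => dsubmx (Z' o : 'cV_(1 + m))).
split => //.
- exact/same_law_sign/standard_normal_entry.
- have msign : measurable_fun setT (fun x : R => (-1) ^+ b * x).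
    exact: measurable_funM.
  exact: (indep_pair_comp msign (@measurable_id _ _ setT) XY).
split=> [ o | ].
  rewrite -LZB -[X in _ *m X](@vsubmxK _ 1 m) mul_block_col mul0mx addr0.
  have uE : usubmx (Z' o : 'cV_(1 + m)) = (entry Z' 0 o)%:M.
    apply/matrixP => i j; rewrite !ord1 !mxE eqxx /entry; congr (Z' o _ _).
    exact: val_inj.
  rewrite uE -scalar_mxM mul_mx_scalar; congr (col_mx _ (_ + _)).
    by rewrite /l mulrACA bb mul1r.
  by rewrite /g scalerA mulrAC bb mul1r.
rewrite -LLB /LB tr_block_mx mulmx_block tr_scalar_mx.
rewrite !trmx0 !mulmx0 !mul0mx !addr0; congr block_mx.
- by rewrite -scalar_mxM /l expr2 mulrACA bb mul1r.
- by rewrite mul_scalar_mx /l /g linearZ/= scalerA mulrAC bb mul1r.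
- by rewrite mul_mx_scalar /l /g scalerA mulrAC bb mul1r.
- by rewrite /g linearZ/= -scalemxAl -scalemxAr scalerA bb scale1r.
Qed.

Theorem standard_normal_linear_law n m1 m2 (L1 : 'M[R]_(n, m1))
    (L2 : 'M[R]_(n, m2)) d1 d2 (T1 : measurableType d1)
    (T2 : measurableType d2) (P1 : probability T1 R) (P2 : probability T2 R)
    (Z1 : T1 -> 'cV[R]_m1) (Z2 : T2 -> 'cV[R]_m2) :
  measurable_fun setT Z1 -> measurable_fun setT Z2 ->
  standard_normal P1 Z1 -> standard_normal P2 Z2 ->
  L1 *m L1^T = L2 *m L2^T ->
  same_law P1 P2 (fun o => L1 *m Z1 o) (fun o => L2 *m Z2 o).
Proof.
elim: n m1 m2 L1 L2 Z1 Z2 => [|n IHn] m1 m2 L1 L2 Z1 Z2 mZ1 mZ2 ZN1 ZN2 LL.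
  (* There is a single vector of dimension 0, so both preimages are [setT] or both are [set0]. *)
  move=> U mU; have [U0|U0] := pselect (U 0).
    rewrite (_ : _ @^-1` U = setT); last first.
      by rewrite -subTset => o _ /=; rewrite [_ *m _]flatmx0.
    rewrite (_ : (fun o : T2 => _) @^-1` U = setT) ?probability_setT//.
    by rewrite -subTset => o _ /=; rewrite [_ *m _]flatmx0.
  rewrite (_ : _ @^-1` U = set0); last first.
    by rewrite -subset0 => o /=; rewrite [_ *m _]flatmx0.
  rewrite (_ : (fun o : T2 => _) @^-1` U = set0) ?measure0//.
  by rewrite -subset0 => o /=; rewrite [_ *m _]flatmx0.
have LLb : block_mx (usubmx (L1 : 'M[R]_(1 + n, _)) *m (usubmx (L1 : 'M[R]_(1 + n, _)))^T)
    (usubmx (L1 : 'M[R]_(1 + n, _)) *m (dsubmx (L1 : 'M[R]_(1 + n, _)))^T)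
    (dsubmx (L1 : 'M[R]_(1 + n, _)) *m (usubmx (L1 : 'M[R]_(1 + n, _)))^T)
    (dsubmx (L1 : 'M[R]_(1 + n, _)) *m (dsubmx (L1 : 'M[R]_(1 + n, _)))^T) =
  block_mx (usubmx (L2 : 'M[R]_(1 + n, _)) *m (usubmx (L2 : 'M[R]_(1 + n, _)))^T)
    (usubmx (L2 : 'M[R]_(1 + n, _)) *m (dsubmx (L2 : 'M[R]_(1 + n, _)))^T)
    (dsubmx (L2 : 'M[R]_(1 + n, _)) *m (usubmx (L2 : 'M[R]_(1 + n, _)))^T)
    (dsubmx (L2 : 'M[R]_(1 + n, _)) *m (dsubmx (L2 : 'M[R]_(1 + n, _)))^T).
  by rewrite -!mul_col_row -!tr_col_mx !vsubmxK.
have [LLu _ _ LLd] := eq_block_mx LLb.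
(* [L L^T] shows whether the first row vanishes, so it does for both matrices or for neither. If it
   does, the head of the vector is constantly 0. *)
have [u10|u10] := eqVneq (usubmx (L1 : 'M[R]_(1 + n, _))) 0.
  have u20 : usubmx (L2 : 'M[R]_(1 + n, _)) = 0.
    by apply: mulmx_trmx_eq0; rewrite -LLu u10 mul0mx.
  have := IHn _ _ _ _ _ _ mZ1 mZ2 ZN1 ZN2 LLd.
  move=> /(same_law_comp (f := fun y => col_mx (0 : 'cV_1) y)) H.
  have E m (L : 'M[R]_(1 + n, m)) (z : 'cV_m) : usubmx L = 0 ->
      L *m z = col_mx (0 : 'cV_1) (dsubmx L *m z).
    by move=> L0; rewrite -{1}[L]vsubmxK L0 mul_col_mx mul0mx.
  have -> : (fun o => L1 *m Z1 o) = _ := funext (fun o => E _ _ (Z1 o) u10).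
  have -> : (fun o => L2 *m Z2 o) = _ := funext (fun o => E _ _ (Z2 o) u20).
  by apply: H; exact: measurable_col_mx.
have u20 : usubmx (L2 : 'M[R]_(1 + n, _)) != 0.
  apply: contraNneq u10 => u20.
  by apply/eqP/mulmx_trmx_eq0; rewrite LLu u20 mul0mx.
have [m1' [l1 [g1 [M1 [X1 [Y1 [[l10 mX1 mY1] XN1 YN1 XY1 [E1 F1]]]]]]]] :=
  standard_normal_pivot mZ1 ZN1 u10.
have [m2' [l2 [g2 [M2 [X2 [Y2 [[l20 mX2 mY2] XN2 YN2 XY2 [E2 F2]]]]]]]] :=
  standard_normal_pivot mZ2 ZN2 u20.
have [l12 _ g12 M12] := eq_block_mx (etrans (esym F1) (etrans LL F2)).
have {l12}l12 : l1 = l2.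
  move/matrixP/(_ 0 0) : l12; rewrite !mxE !eqxx !mulr1n => /eqP.
  by rewrite eqrXn2 ?ltW// => /eqP.
have {g12}g12 : g1 = g2.
  by move: g12; rewrite l12; apply: scalerI; rewrite gt_eqF.
have {M12}M12 : M1 *m M1^T = M2 *m M2^T by move: M12; rewrite g12 => /addrI.
have MY := IHn _ _ _ _ _ _ mY1 mY2 YN1 YN2 M12.
have X12 : same_law P1 P2 X1 X2 by apply: same_law_trans XN1 _; exact: same_law_sym.
have mul_indep d (T : measurableType d) (P : probability T R) m (X : T -> R)
    (Y : T -> 'cV_m) (M : 'M[R]_(n, m)) : indep_pair P X Y ->
    indep_pair P X (fun o => M *m Y o).
  move=> XY; apply: (indep_pair_comp (@measurable_id _ _ setT) _ XY).
  exact: measurable_mulmx.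
have := same_law_pair mX1 (measurable_linear_rv M1 mY1) mX2
  (measurable_linear_rv M2 mY2) (mul_indep _ _ _ _ _ _ M1 XY1)
  (mul_indep _ _ _ _ _ _ M2 XY2) X12 MY.
move=> /(same_law_comp (f := fun z : R * 'cV[R]_n =>
  col_mx (l1 * z.1)%:M (z.1 *: g1 + z.2) : 'cV[R]_(1 + n))) H.
have -> : (fun o => L1 *m Z1 o) = _ := funext E1.
have -> : (fun o => L2 *m Z2 o) = _ := funext E2.
rewrite -l12 -g12.
apply: H; apply: measurable_col_mx.
  apply: measurable_mxP => i j; rewrite !ord1; under eq_fun do rewrite mxE eqxx mulr1n.
  exact: measurable_funM.
apply: measurable_addmx => //; apply: measurable_mxP => i j.
under eq_fun do rewrite mxE; exact: measurable_funM.
Qed.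

End uniqueness.

(** * Second moments *)

Section square_integrability.
Context {R : realType} d (T : measurableType d) (P : probability T R).
Implicit Types f g : T -> R.

Definition integrable_rv f := P.-integrable setT (EFin \o f).

Definition sq_integrable_rv f :=
  measurable_fun setT f /\ integrable_rv (fun o => f o ^+ 2).

(** Real-valued, so that matrix moments are computed in [R]; [fine] sends infinite values to 0,
    hence the integrability premises of the linearity lemmas. *)
Definition real_expectation f : R := fine (\int[P]_o (f o)%:E).
Local Notation EE := real_expectation.

Lemma integrable_rvD f g : integrable_rv f -> integrable_rv g ->
  integrable_rv (fun o => f o + g o).
Proof. by move=> If Ig; exact: (integrableD measurableT If Ig). Qed.

Lemma integrable_rvZ a f : integrable_rv f -> integrable_rv (fun o => a * f o).
Proof. by move=> If; exact: (integrableZl measurableT a If). Qed.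

Lemma integrable_rv_cst a : integrable_rv (fun=> a).
Proof. exact: finite_measure_integrable_cst. Qed.

Lemma integrable_rv_sum (I : Type) (r : seq I) (F : I -> T -> R) :
  (forall i, integrable_rv (F i)) -> integrable_rv (fun o => \sum_(i <- r) F i o).
Proof.
move=> IF; elim: r => [|i r IHr].
  by under eq_fun do rewrite big_nil; exact: integrable_rv_cst.
by under eq_fun do rewrite big_cons; exact: integrable_rvD.
Qed.

Lemma integrable_rv_le f g : measurable_fun setT f ->
  (forall o, `|f o| <= g o) -> integrable_rv g -> integrable_rv f.
Proof.
move=> mf fg; apply: le_integrable => //; first exact/measurable_EFinP.
by move=> o _; rewrite /= lee_fin (le_trans (fg o))// ler_norm.
Qed.

Lemma expectationDr f g : integrable_rv f -> integrable_rv g ->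
  EE (fun o => f o + g o) = EE f + EE g.
Proof.
move=> If Ig; rewrite /EE -fineD ?integrable_fin_num//.
by rewrite -integralD.
Qed.

Lemma expectationZr a f : integrable_rv f -> EE (fun o => a * f o) = a * EE f.
Proof.
move=> If; rewrite /EE; under eq_integral do rewrite EFinM.
by rewrite integralZl// fineM// integrable_fin_num.
Qed.

Lemma expectation_cstr a : EE (fun=> a) = a.
Proof. by rewrite /EE integral_cst//= probability_setT mule1. Qed.

Lemma expectation_sumr (I : Type) (r : seq I) (F : I -> T -> R) :
  (forall i, integrable_rv (F i)) ->
  EE (fun o => \sum_(i <- r) F i o) = \sum_(i <- r) EE (F i).
Proof.
move=> IF; elim: r => [|i r IHr].
  by under eq_fun do rewrite big_nil; rewrite expectation_cstr big_nil.
under eq_fun do rewrite big_cons.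
by rewrite expectationDr// ?IHr ?big_cons//; exact: integrable_rv_sum.
Qed.

(** [|f g|] is dominated by [f^2 + g^2]. *)
Lemma sq_integrable_mul f g : sq_integrable_rv f -> sq_integrable_rv g ->
  integrable_rv (fun o => f o * g o).
Proof.
move=> [mf If] [mg Ig]; apply: integrable_rv_le (integrable_rvD If Ig).
  exact: measurable_funM.
move=> o /=; rewrite ler_norml.
have := sqr_ge0 (f o); have := sqr_ge0 (g o).
have := sqr_ge0 (f o + g o); have := sqr_ge0 (f o - g o).
by rewrite sqrrB sqrrD => *; apply/andP; split; lra.
Qed.

Lemma sq_integrable_cst a : sq_integrable_rv (fun=> a).
Proof. by split => //; exact: integrable_rv_cst. Qed.

Lemma sq_integrable_integrable f : sq_integrable_rv f -> integrable_rv f.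
Proof.
move=> sf; have := sq_integrable_mul sf (sq_integrable_cst 1).
by under eq_fun do rewrite mulr1.
Qed.

Lemma sq_integrableD f g : sq_integrable_rv f -> sq_integrable_rv g ->
  sq_integrable_rv (fun o => f o + g o).
Proof.
move=> [mf If] [mg Ig]; have mfg := measurable_funD mf mg; split => //.
apply: integrable_rv_le (integrable_rvZ 2 (integrable_rvD If Ig)).
  exact: measurable_funX.
move=> o /=; rewrite ger0_norm ?sqr_ge0//.
by have := sqr_ge0 (f o - g o); rewrite sqrrB sqrrD; lra.
Qed.

Lemma sq_integrableZ a f : sq_integrable_rv f ->
  sq_integrable_rv (fun o => a * f o).
Proof.
move=> [mf If]; split; first exact: measurable_funM.
by under eq_fun do rewrite exprMn; exact: integrable_rvZ.
Qed.

Lemma sq_integrable_sum (I : Type) (r : seq I) (F : I -> T -> R) :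
  (forall i, sq_integrable_rv (F i)) ->
  sq_integrable_rv (fun o => \sum_(i <- r) F i o).
Proof.
move=> IF; elim: r => [|i r IHr].
  by under eq_fun do rewrite big_nil; exact: sq_integrable_cst.
by under eq_fun do rewrite big_cons; exact: sq_integrableD.
Qed.

End square_integrability.

(** * Moments of random matrices *)

Section matrix_moments.
Context {R : realType} d (T : measurableType d) (P : probability T R).
Local Notation EE := (real_expectation P).

Definition integrable_mx m n (M : T -> 'M[R]_(m, n)) :=
  forall i j, integrable_rv P (fun o => M o i j).

Definition sq_integrable_mx m n (M : T -> 'M[R]_(m, n)) :=
  forall i j, sq_integrable_rv P (fun o => M o i j).

Lemma mean_mxE m n (M : T -> 'M[R]_(m, n)) i j :
  mean_mx P M i j = EE (fun o => M o i j).
Proof. by rewrite mxE unlock. Qed.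

Lemma integrable_mxD m n (M N : T -> 'M[R]_(m, n)) :
  integrable_mx M -> integrable_mx N -> integrable_mx (fun o => M o + N o).
Proof.
by move=> IM IN i j; under eq_fun do rewrite mxE; exact: integrable_rvD.
Qed.

Lemma mean_mxD m n (M N : T -> 'M[R]_(m, n)) :
  integrable_mx M -> integrable_mx N ->
  mean_mx P (fun o => M o + N o) = mean_mx P M + mean_mx P N.
Proof.
move=> IM IN; apply/matrixP => i j; rewrite !mean_mxE mxE !mean_mxE.
by under eq_fun do rewrite mxE; rewrite expectationDr.
Qed.

Lemma mean_mx_cst m n (C : 'M[R]_(m, n)) : mean_mx P (fun=> C) = C.
Proof. by apply/matrixP => i j; rewrite mean_mxE expectation_cstr. Qed.

Lemma integrable_mx_cst m n (C : 'M[R]_(m, n)) : integrable_mx (fun=> C).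
Proof. by move=> i j; exact: integrable_rv_cst. Qed.

Lemma integrable_mx_mull m n p (A : 'M[R]_(m, n)) (M : T -> 'M[R]_(n, p)) :
  integrable_mx M -> integrable_mx (fun o => A *m M o).
Proof.
move=> IM i j; under eq_fun do rewrite mxE.
by apply: integrable_rv_sum => k; exact: integrable_rvZ.
Qed.

Lemma mean_mx_mull m n p (A : 'M[R]_(m, n)) (M : T -> 'M[R]_(n, p)) :
  integrable_mx M -> mean_mx P (fun o => A *m M o) = A *m mean_mx P M.
Proof.
move=> IM; apply/matrixP => i j; rewrite mean_mxE mxE.
under eq_fun do rewrite mxE.
rewrite expectation_sumr; last by move=> k; exact: integrable_rvZ.
by apply: eq_bigr => k _; rewrite expectationZr// mean_mxE.
Qed.

Lemma mean_mx_tr m n (M : T -> 'M[R]_(m, n)) :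
  mean_mx P (fun o => (M o)^T) = (mean_mx P M)^T.
Proof.
apply/matrixP => i j; rewrite mean_mxE mxE mean_mxE.
by under eq_fun do rewrite mxE.
Qed.

Lemma integrable_mx_mulr m n p (M : T -> 'M[R]_(m, n)) (B : 'M[R]_(n, p)) :
  integrable_mx M -> integrable_mx (fun o => M o *m B).
Proof.
move=> IM i j; under eq_fun do rewrite mxE.
apply: integrable_rv_sum => k; under eq_fun do rewrite mulrC.
exact: integrable_rvZ.
Qed.

Lemma mean_mx_mulr m n p (M : T -> 'M[R]_(m, n)) (B : 'M[R]_(n, p)) :
  integrable_mx M -> mean_mx P (fun o => M o *m B) = mean_mx P M *m B.
Proof.
move=> IM; apply/matrixP => i j; rewrite mean_mxE mxE.
under eq_fun do rewrite mxE.
rewrite expectation_sumr; last first.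
  by move=> k; under eq_fun do rewrite mulrC; exact: integrable_rvZ.
apply: eq_bigr => k _; under eq_fun do rewrite mulrC.
by rewrite expectationZr// mean_mxE mulrC.
Qed.

Lemma sq_integrable_mxD m n (M N : T -> 'M[R]_(m, n)) :
  sq_integrable_mx M -> sq_integrable_mx N ->
  sq_integrable_mx (fun o => M o + N o).
Proof.
by move=> IM IN i j; under eq_fun do rewrite mxE; exact: sq_integrableD.
Qed.

Lemma sq_integrable_mx_cst m n (C : 'M[R]_(m, n)) : sq_integrable_mx (fun=> C).
Proof. by move=> i j; exact: sq_integrable_cst. Qed.

Lemma sq_integrable_mx_mull m n p (A : 'M[R]_(m, n)) (M : T -> 'M[R]_(n, p)) :
  sq_integrable_mx M -> sq_integrable_mx (fun o => A *m M o).
Proof.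
move=> IM i j; under eq_fun do rewrite mxE.
by apply: sq_integrable_sum => k; exact: sq_integrableZ.
Qed.

Lemma sq_integrable_mx_integrable m n (M : T -> 'M[R]_(m, n)) :
  sq_integrable_mx M -> integrable_mx M.
Proof. by move=> IM i j; exact: sq_integrable_integrable. Qed.

Lemma integrable_mx_outer m n (X : T -> 'cV[R]_m) (Y : T -> 'cV[R]_n) :
  sq_integrable_mx X -> sq_integrable_mx Y ->
  integrable_mx (fun o => X o *m (Y o)^T).
Proof.
move=> IX IY i j; under eq_fun do rewrite mxE big_ord1 mxE.
exact: sq_integrable_mul.
Qed.

Lemma square_integrableP n (X : T -> 'cV[R]_n) : measurable_fun setT X ->
  square_integrable P X <-> sq_integrable_mx X.
Proof.
move=> mX; split => [sX i j|sX i].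
  rewrite ord1; split; first exact: measurable_entry.
  apply/integrableP; split.
    by apply/measurable_EFinP/measurable_funX/measurable_entry.
  have := sX i; rewrite unlock; congr (_ < _)%E.
  by apply: eq_integral => o _ /=; rewrite ger0_norm ?sqr_ge0.
have [_ /integrableP[_]] := sX i 0; rewrite unlock; congr (_ < _)%E.
by apply: eq_integral => o _ /=; rewrite ger0_norm ?sqr_ge0.
Qed.

End matrix_moments.

Section law_moments.
Context {R : realType}.

Lemma same_law_integrable d1 d2 d (T1 : measurableType d1)
    (T2 : measurableType d2) (S : measurableType d) (P1 : probability T1 R)
    (P2 : probability T2 R) (X1 : T1 -> S) (X2 : T2 -> S) (f : S -> R) :
  measurable_fun setT X1 -> measurable_fun setT X2 -> measurable_fun setT f ->
  same_law P1 P2 X1 X2 ->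
  integrable_rv P2 (fun o => f (X2 o)) -> integrable_rv P1 (fun o => f (X1 o)).
Proof.
move=> mX1 mX2 mf X12 /integrableP[_ If]; apply/integrableP; split.
  by apply/measurable_EFinP; exact: (measurableT_comp mf mX1).
have mf' : measurable_fun setT (fun x => `|(f x)%:E|%E).
  by apply: measurableT_comp => //; exact/measurable_EFinP.
by have -> := same_law_integral mX1 mX2 mf' X12.
Qed.

Lemma same_law_expectation d1 d2 d (T1 : measurableType d1)
    (T2 : measurableType d2) (S : measurableType d) (P1 : probability T1 R)
    (P2 : probability T2 R) (X1 : T1 -> S) (X2 : T2 -> S) (f : S -> R) :
  measurable_fun setT X1 -> measurable_fun setT X2 -> measurable_fun setT f ->
  same_law P1 P2 X1 X2 ->
  real_expectation P1 (fun o => f (X1 o)) =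
  real_expectation P2 (fun o => f (X2 o)).
Proof.
move=> mX1 mX2 mf X12; congr fine.
have /measurable_EFinP mf' := mf.
exact: (same_law_integral mX1 mX2 mf' X12).
Qed.

(** [E F(V) = E F(s V) = - E F(V)]. All vanishing moments below, including the covariance of state
    and noise, come from such a symmetry. *)
Lemma antisymmetric_expectation d d' (T : measurableType d)
    (S : measurableType d') (P : probability T R) (V : T -> S) (s : S -> S)
    (F : S -> R) :
  measurable_fun setT V -> measurable_fun setT s -> measurable_fun setT F ->
  same_law P P V (fun o => s (V o)) -> (forall v, F (s v) = - F v) ->
  integrable_rv P (fun o => F (V o)) ->
  real_expectation P (fun o => F (V o)) = 0.
Proof.
move=> mV ms mF sV Fs IF.
have := same_law_expectation mV (measurableT_comp ms mV) mF sV.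
under [in X in _ = X]eq_fun do rewrite /= Fs -mulN1r.
rewrite expectationZr// mulN1r; lra.
Qed.

Lemma same_law_mean_mx d1 d2 d (T1 : measurableType d1)
    (T2 : measurableType d2) (S : measurableType d) (P1 : probability T1 R)
    (P2 : probability T2 R) (X1 : T1 -> S) (X2 : T2 -> S) m n
    (f : S -> 'M[R]_(m, n)) :
  measurable_fun setT X1 -> measurable_fun setT X2 -> measurable_fun setT f ->
  same_law P1 P2 X1 X2 ->
  mean_mx P1 (fun o => f (X1 o)) = mean_mx P2 (fun o => f (X2 o)).
Proof.
move=> mX1 mX2 mf X12; apply/matrixP => i j; rewrite !mean_mxE.
by apply: (same_law_expectation (f := fun x => f x i j)) => //; exact: measurable_entry.
Qed.

Lemma same_law_sq_integrable_mx d1 d2 d (T1 : measurableType d1)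
    (T2 : measurableType d2) (S : measurableType d) (P1 : probability T1 R)
    (P2 : probability T2 R) (X1 : T1 -> S) (X2 : T2 -> S) m n
    (f : S -> 'M[R]_(m, n)) :
  measurable_fun setT X1 -> measurable_fun setT X2 -> measurable_fun setT f ->
  same_law P1 P2 X1 X2 ->
  sq_integrable_mx P2 (fun o => f (X2 o)) ->
  sq_integrable_mx P1 (fun o => f (X1 o)).
Proof.
move=> mX1 mX2 mf X12 If i j; have [_ Iij] := If i j.
have mfij : measurable_fun setT (fun x => f x i j) by exact: measurable_entry.
split; first exact: (measurableT_comp mfij mX1).
have mfij2 : measurable_fun setT (fun x => f x i j ^+ 2) by exact: measurable_funX.
exact: (same_law_integrable mX1 mX2 mfij2 X12 Iij).
Qed.

End law_moments.

(** * Gaussian vectors *)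

Section gaussian.
Context {R : realType}.
Local Notation N01 := (@std_normal R).

(** Replacing [w] by [- w] preserves the joint law with [X] and negates the integrand. *)
Lemma indep_symmetric_expectation d d1 (T : measurableType d)
    (S : measurableType d1) (P : probability T R) (X : T -> S) (w : T -> R)
    (f : S -> R) :
  measurable_fun setT X -> measurable_fun setT w -> measurable_fun setT f ->
  indep_pair P X w -> same_law P P w (fun o => - w o) ->
  integrable_rv P (fun o => f (X o) * w o) ->
  real_expectation P (fun o => f (X o) * w o) = 0.
Proof.
move=> mX mw mf Xw sw IXw.
have mN : measurable_fun setT (-%R : R -> R) by [].
apply: (antisymmetric_expectation (V := fun o => (X o, w o))
  (s := fun z => (z.1, - z.2)) (F := fun z => f z.1 * z.2)) => //=.
- exact: measurable_fun_pair.
- by apply: measurable_fun_pair => //; exact: measurableT_comp.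
- by apply: measurable_funM => //; exact: measurableT_comp.
- apply: (same_law_pair mX mw mX (measurableT_comp mN mw) Xw _ _ sw) => //.
  exact: (indep_pair_comp (@measurable_id _ _ setT) mN Xw).
- by move=> v; rewrite mulrN.
Qed.

Section standard.
Context d (T : measurableType d) (P : probability T R) n (Z : T -> 'cV[R]_n).
Hypotheses (mZ : measurable_fun setT Z) (ZN : standard_normal P Z).

Let law i : same_law P N01 (entry Z i) id := standard_normal_entry i ZN.

Let mE i : measurable_fun setT (entry Z i) := measurable_entry i 0 mZ.

Lemma std_normal_sqr : (\int[N01]_x (x ^+ 2)%:E = 1)%E.
Proof.
rewrite ge0_integral_std_normal.
- rewrite -[RHS](@integral_sqr_std_normal_pdf R).
  by apply: eq_integral => x _; rewrite EFinM.
- by apply/measurable_EFinP; exact: measurable_funX.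
- by move=> x; rewrite lee_fin sqr_ge0.
Qed.

Lemma standard_normal_sq_integrable : sq_integrable_mx P Z.
Proof.
move=> i j; rewrite ord1; split; first exact: mE.
have msq : measurable_fun setT (fun x : R => x ^+ 2) by exact: measurable_funX.
apply: (same_law_integrable (mE i) (@measurable_id _ _ setT) msq (law i)).
apply/integrableP; split.
  by apply/measurable_EFinP; exact: measurable_funX.
rewrite (_ : (\int[_]_x _ = 1)%E) ?ltry// -std_normal_sqr.
by apply: eq_integral => x _ /=; rewrite ger0_norm ?sqr_ge0.
Qed.

Lemma standard_normal_entry_sym i : same_law P P (entry Z i) (fun o => - entry Z i o).
Proof.
apply: same_law_trans (law i) _; apply: same_law_sym.
have := same_law_sign true (law i).
by under eq_fun do rewrite expr1 mulN1r.
Qed.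

Lemma standard_normal_mean : mean_mx P Z = 0.
Proof.
apply/matrixP => i j; rewrite ord1 mean_mxE mxE.
have mN : measurable_fun setT (-%R : R -> R) by [].
apply: (antisymmetric_expectation (F := id) (mE i) mN _ (standard_normal_entry_sym i)) => //.
exact: sq_integrable_integrable (standard_normal_sq_integrable i 0).
Qed.

Lemma standard_normal_second_moment : mean_mx P (fun o => Z o *m (Z o)^T) = 1%:M.
Proof.
apply/matrixP => i j; rewrite mean_mxE mxE.
under eq_fun do rewrite mxE big_ord1 mxE.
have [<-|ij] := eqVneq i j.
  have msq : measurable_fun setT (fun x : R => x * x) by exact: measurable_funM.
  rewrite (same_law_expectation (mE i) (@measurable_id _ _ setT) msq (law i)).
  rewrite /real_expectation; under eq_integral do rewrite -expr2.
  by rewrite std_normal_sqr.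
apply: (indep_symmetric_expectation (f := id) (mE i) (mE j)) => //.
- exact: standard_normal_indep_pair.
- exact: standard_normal_entry_sym.
- by apply: sq_integrable_mul; exact: standard_normal_sq_integrable.
Qed.

End standard.

Lemma measurable_affine_rv d (T : measurableType d) n m (L : 'M[R]_(n, m))
    (b : 'cV[R]_n) (Z : T -> 'cV[R]_m) :
  measurable_fun setT Z -> measurable_fun setT (fun o => b + L *m Z o).
Proof. by move=> mZ; apply: measurable_addmx => //; exact: measurable_mulmx. Qed.

Lemma gaussianP d (T : measurableType d) (P : probability T R) n
    (X : T -> 'cV[R]_n) mu Sigma :
  gaussian P X mu Sigma <->
  exists (m : nat) (L : 'M[R]_(n, m)) (d' : measure_display)
      (T' : measurableType d') (P' : probability T' R)
      (Z : T' -> 'cV[R]_m),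
    [/\ measurable_fun setT Z, standard_normal P' Z, L *m L^T = Sigma &
        same_law P P' X (fun o => mu + L *m Z o)].
Proof.
split=> [[m [L [d' [T' [P' [Z [ZN LS XZ]]]]]]]|
         [m [L [d' [T' [P' [Z [mZ ZN LS XZ]]]]]]]].
  by exists m, L, d', T', P', Z; split.
by exists m, L, d', T', P', (mfun_of mZ); split.
Qed.

Lemma gaussian_law d (T : measurableType d) (P : probability T R)
    d' (T' : measurableType d') (P' : probability T' R) n
    (X : T -> 'cV[R]_n) (X' : T' -> 'cV[R]_n) mu Sigma :
  gaussian P X mu Sigma -> same_law P P' X X' -> gaussian P' X' mu Sigma.
Proof.
move=> /gaussianP[m [L [d1 [T1 [P1 [Z [mZ ZN LS XZ]]]]]]] XX'.
apply/gaussianP; exists m, L, d1, T1, P1, Z; split => //.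
exact: same_law_trans (same_law_sym XX') XZ.
Qed.

(** The bridge between the closed loop and the realization hidden in [feasible]. *)
Lemma gaussian_unique d (T : measurableType d) (P : probability T R)
    d' (T' : measurableType d') (P' : probability T' R) n
    (X : T -> 'cV[R]_n) (X' : T' -> 'cV[R]_n) mu Sigma :
  gaussian P X mu Sigma -> gaussian P' X' mu Sigma -> same_law P P' X X'.
Proof.
move=> /gaussianP[m1 [L1 [d1 [T1 [P1 [Z1 [mZ1 ZN1 LS1 XZ1]]]]]]].
move=> /gaussianP[m2 [L2 [d2 [T2 [P2 [Z2 [mZ2 ZN2 LS2 XZ2]]]]]]].
apply: same_law_trans XZ1 _; apply: same_law_trans (same_law_sym XZ2).
apply: (same_law_comp (f := fun y => mu + y)); first exact: measurable_addmx.
by apply: standard_normal_linear_law => //; rewrite LS1.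
Qed.

Lemma gaussian_affine d (T : measurableType d) (P : probability T R) n p
    (X : T -> 'cV[R]_n) mu Sigma (A : 'M[R]_(p, n)) (b : 'cV[R]_p) :
  gaussian P X mu Sigma ->
  gaussian P (fun o => b + A *m X o) (b + A *m mu) (A *m Sigma *m A^T).
Proof.
move=> /gaussianP[m [L [d1 [T1 [P1 [Z [mZ ZN LS XZ]]]]]]].
apply/gaussianP; exists m, (A *m L), d1, T1, P1, Z; split => //.
  by rewrite trmx_mul -LS !mulmxA.
have := same_law_comp (f := fun y => b + A *m y) (measurable_affine_rv A b (@measurable_id _ _ setT)) XZ.
by under [X in same_law _ _ _ X -> _]eq_fun do rewrite mulmxDr addrA mulmxA.
Qed.

Lemma gaussian_cst d (T : measurableType d) (P : probability T R) n
    (X : T -> 'cV[R]_n) (c : 'cV[R]_n) :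
  (forall o, X o = c) -> gaussian P X c 0.
Proof.
move=> Xc; apply/gaussianP.
(* No columns at all: the empty vector is standard normal on any probability space. *)
exists 0%N, 0, d, T, P, (fun=> 0); split => //.
- apply/standard_normalP => // U mU; rewrite !big_ord0.
  exact: probability_setT.
- by rewrite mul0mx.
- by move=> U mU; congr (P (_ @^-1` U)); apply/funext => o; rewrite Xc mul0mx addr0.
Qed.

Section moments.
Context d (T : measurableType d) (P : probability T R) n (X : T -> 'cV[R]_n)
  (mu : 'cV[R]_n) (Sigma : 'M[R]_n).
Hypotheses (mX : measurable_fun setT X) (XG : gaussian P X mu Sigma).

Lemma gaussian_sq_integrable : sq_integrable_mx P X.
Proof.
have /gaussianP[m [L [d1 [T1 [P1 [Z [mZ ZN LS XZ]]]]]]] := XG.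
apply: (same_law_sq_integrable_mx (f := id) mX (measurable_affine_rv L mu mZ)
  (@measurable_id _ _ setT) XZ).
apply: sq_integrable_mxD; first exact: sq_integrable_mx_cst.
exact/sq_integrable_mx_mull/standard_normal_sq_integrable.
Qed.

Lemma gaussian_mean : mean_mx P X = mu.
Proof.
have /gaussianP[m [L [d1 [T1 [P1 [Z [mZ ZN LS XZ]]]]]]] := XG.
rewrite (same_law_mean_mx (f := id) mX (measurable_affine_rv L mu mZ)
  (@measurable_id _ _ setT) XZ).
have IZ := sq_integrable_mx_integrable (standard_normal_sq_integrable mZ ZN).
rewrite mean_mxD; [|exact: integrable_mx_cst|exact: integrable_mx_mull].
by rewrite mean_mx_cst mean_mx_mull// standard_normal_mean// mulmx0 addr0.
Qed.

Lemma gaussian_cov : cov_mx P X = Sigma.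
Proof.
have /gaussianP[m [L [d1 [T1 [P1 [Z [mZ ZN LS XZ]]]]]]] := XG.
rewrite /cov_mx gaussian_mean.
have mf : measurable_fun setT (fun y : 'cV[R]_n => (y - mu) *m (y - mu)^T).
  have ms : measurable_fun setT (fun y : 'cV[R]_n => y - mu).
    exact: measurable_addmx.
  by apply: measurable_mulmx => //; exact: measurable_trmx.
rewrite (same_law_mean_mx mX (measurable_affine_rv L mu mZ) mf XZ).
have IZ := standard_normal_sq_integrable mZ ZN.
transitivity (mean_mx P1 (fun o => L *m ((Z o *m (Z o)^T) *m L^T))).
  congr mean_mx; apply/funext => o.
  by rewrite addrC addKr trmx_mul !mulmxA.
rewrite mean_mx_mull; last exact/integrable_mx_mulr/integrable_mx_outer.
rewrite mean_mx_mulr; last exact: integrable_mx_outer.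
by rewrite standard_normal_second_moment// mul1mx.
Qed.

End moments.

Lemma standard_normal_col_mx d1 d2 (T1 : measurableType d1)
    (T2 : measurableType d2) (P1 : probability T1 R) (P2 : probability T2 R)
    m1 m2 (Z1 : T1 -> 'cV[R]_m1) (Z2 : T2 -> 'cV[R]_m2) :
  measurable_fun setT Z1 -> measurable_fun setT Z2 ->
  standard_normal P1 Z1 -> standard_normal P2 Z2 ->
  standard_normal (P1 \x P2)%E (fun z => col_mx (Z1 z.1) (Z2 z.2)).
Proof.
move=> mZ1 mZ2 /(standard_normalP P1 mZ1) N1 /(standard_normalP P2 mZ2) N2.
apply/standard_normalP.
  by apply: measurable_col_mx; exact: measurableT_comp.
move=> U mU.
pose U1 i := U (lshift m2 i); pose U2 i := U (rshift m1 i).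
rewrite [in RHS]big_split_ord/= -preimage_box.
have mbox n (Z : 'I_n -> set R) : (forall i, measurable (Z i)) -> measurable (box Z).
  by move=> mZ; rewrite measurable_boxes; apply: sub_sigma_algebra; exists Z.
transitivity ((P1 \x P2)%E ((Z1 @^-1` box U1) `*` (Z2 @^-1` box U2))).
  apply: (congr1 (P1 \x P2)%E); apply/seteqP; split => -[t1 t2] /=.
    move=> H; split => i; first by have := H (lshift m2 i); rewrite col_mxEu.
    by have := H (rshift m1 i); rewrite col_mxEd.
  move=> [H1 H2] i; rewrite mxE; case: splitP => k ik.
    by rewrite (_ : i = lshift m2 k); [exact: H1|exact: val_inj].
  by rewrite (_ : i = rshift m1 k); [exact: H2|exact: val_inj].
transitivity (P1 (Z1 @^-1` box U1) * P2 (Z2 @^-1` box U2))%E.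
  apply: product_measure1E.
    by apply: measurable_preimage => //; apply: mbox => i; exact: mU.
  by apply: measurable_preimage => //; apply: mbox => i; exact: mU.
rewrite !preimage_box; congr (_ * _)%E.
  by apply: N1 => i; exact: mU.
by apply: N2 => i; exact: mU.
Qed.

(** Stacking independent [Z1] and [Z2] on the product space, the factor [row_mx L1 L2] has Gram
    matrix [S + Q]. *)
Lemma gaussian_add d (T : measurableType d) (P : probability T R) n
    (X Y : T -> 'cV[R]_n) mu nu S Q :
  measurable_fun setT X -> measurable_fun setT Y -> indep_pair P X Y ->
  gaussian P X mu S -> gaussian P Y nu Q ->
  gaussian P (fun o => X o + Y o) (mu + nu) (S + Q).
Proof.
move=> mX mY XY.
move=> /gaussianP[m1 [L1 [d1 [T1 [P1 [Z1 [mZ1 ZN1 LS1 XZ1]]]]]]].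
move=> /gaussianP[m2 [L2 [d2 [T2 [P2 [Z2 [mZ2 ZN2 LS2 YZ2]]]]]]].
apply/gaussianP; exists (m1 + m2)%N, (row_mx L1 L2), _, (T1 * T2)%type, (P1 \x P2)%E,
  (fun z => col_mx (Z1 z.1) (Z2 z.2)).
have mZ1' : measurable_fun setT (fun z : T1 * T2 => Z1 z.1) by exact: measurableT_comp.
have mZ2' : measurable_fun setT (fun z : T1 * T2 => Z2 z.2) by exact: measurableT_comp.
split => //.
- exact: measurable_col_mx.
- exact: standard_normal_col_mx.
- by rewrite tr_row_mx mul_row_col LS1 LS2.
have ma1 := measurable_affine_rv L1 mu mZ1; have ma2 := measurable_affine_rv L2 nu mZ2.
have ma1' := measurable_affine_rv L1 mu mZ1'; have ma2' := measurable_affine_rv L2 nu mZ2'.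
have XYZ : same_law P (P1 \x P2)%E (fun o => (X o, Y o))
    (fun z => (mu + L1 *m Z1 z.1, nu + L2 *m Z2 z.2)).
  apply: same_law_pair => //.
  - exact: (indep_pair_comp ma1 ma2 (@indep_product _ _ _ _ _ P1 P2)).
  - apply: same_law_trans XZ1 _ => U mU; apply/esym.
    exact: (product_probability_fst P1 P2 (measurable_preimage ma1 mU)).
  - apply: same_law_trans YZ2 _ => U mU; apply/esym.
    exact: (product_probability_snd P1 P2 (measurable_preimage ma2 mU)).
have madd : measurable_fun setT (fun z : 'cV[R]_n * 'cV[R]_n => z.1 + z.2).
  exact: measurable_addmx.
have := same_law_comp madd XYZ.
rewrite (_ : (fun z : T1 * T2 => _) =
  fun z => mu + nu + row_mx L1 L2 *m col_mx (Z1 z.1) (Z2 z.2))//.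
by apply/funext => z; rewrite /= addrACA -mul_row_col.
Qed.

End gaussian.

(** * Chance constraints and the terminal ingredients *)

Section quadratic_forms.
Context {R : realType}.

Lemma quadfD n (M N : 'M[R]_n) v : quadf (M + N) v = quadf M v + quadf N v.
Proof. by rewrite /quadf mulmxDr mulmxDl mxE. Qed.

Lemma quadfB n (M N : 'M[R]_n) v : quadf (M - N) v = quadf M v - quadf N v.
Proof. by rewrite /quadf mulmxBr mulmxBl !mxE. Qed.

Lemma quadf_congr n m (K : 'M[R]_(n, m)) (M : 'M[R]_m) v :
  quadf (K *m M *m K^T) v = quadf M (K^T *m v).
Proof. by rewrite /quadf trmx_mul trmxK !mulmxA. Qed.

Lemma quadf_gram n m (L : 'M[R]_(n, m)) v :
  quadf (L *m L^T) v = \sum_k (L^T *m v) k 0 ^+ 2.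
Proof.
rewrite -[L in L *m _]mulmx1 quadf_congr /quadf mulmx1 mxE.
by apply: eq_bigr => k _; rewrite mxE expr2.
Qed.

Lemma quadf_gram_ge0 n m (L : 'M[R]_(n, m)) v : 0 <= quadf (L *m L^T) v.
Proof. by rewrite quadf_gram sumr_ge0// => k _; exact: sqr_ge0. Qed.

Lemma loewner_quadf n (M N : 'M[R]_n) v :
  loewner_le M N -> quadf M v <= quadf N v.
Proof. by move=> [_ /(_ v)]; rewrite quadfB subr_ge0. Qed.

Lemma quadf_mx11 n (M : 'M[R]_n) (a : 'cV[R]_n) : a^T *m M *m a = (quadf M a)%:M.
Proof. by apply/matrixP => i j; rewrite !ord1 [RHS]mxE eqxx. Qed.

End quadratic_forms.

Section chance.
Context {R : realType}.
Local Notation N01 := (@std_normal R).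

Lemma gaussian_quadf_ge0 d (T : measurableType d) (P : probability T R) n
    (X : T -> 'cV[R]_n) mu Sigma a :
  gaussian P X mu Sigma -> 0 <= quadf Sigma a.
Proof. by move=> [m [L [? [? [? [? [_ <- _]]]]]]]; exact: quadf_gram_ge0. Qed.

Lemma standard_normal_scalar : standard_normal N01 (fun x : R => x%:M : 'cV[R]_1).
Proof.
have mM : measurable_fun setT (fun x : R => x%:M : 'cV[R]_1).
  apply: measurable_mxP => i j; rewrite !ord1.
  under eq_fun do rewrite mxE eqxx mulr1n.
  exact: measurable_id.
apply/standard_normalP => // U mU; rewrite !big_ord1; congr (N01 _).
rewrite (_ : entry _ _ = id)//.
by apply/funext => x; rewrite /entry mxE eqxx mulr1n.
Qed.

(** The scalar [a^T X] is compared in law with [a^T mu + s x], [x] standard normal. There is no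
    division by [s], which may be 0. *)
Lemma gaussian_dotv_le d (T : measurableType d) (P : probability T R) n
    (X : T -> 'cV[R]_n) mu Sigma (a : 'cV[R]_n) (b : R) :
  gaussian P X mu Sigma ->
  P [set o | dotv a (X o) <= b] =
  N01 [set x | dotv a mu + Num.sqrt (quadf Sigma a) * x <= b].
Proof.
move=> XG; set s := Num.sqrt _.
have aXG := gaussian_affine a^T 0 XG.
have YG : gaussian N01 (fun x : R => (0 + a^T *m mu) + s%:M *m x%:M)
    (0 + a^T *m mu) (a^T *m Sigma *m a^T^T).
  apply/gaussianP; exists 1%N, s%:M, _, R, N01, (fun x => x%:M); split => //.
  - apply: measurable_mxP => i j; rewrite !ord1.
    under eq_fun do rewrite mxE eqxx mulr1n.
    exact: measurable_id.
  - exact: standard_normal_scalar.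
  - rewrite trmxK quadf_mx11 tr_scalar_mx -scalar_mxM -expr2 sqr_sqrtr//.
    exact: gaussian_quadf_ge0 XG.
have mU : measurable [set y : 'cV[R]_1 | y 0 0 <= b].
  rewrite (_ : [set y | _] = (fun y : 'cV[R]_1 => y 0 0) @^-1` `]-oo, b]).
    by apply: measurable_preimage => //; exact: measurable_mx_entry.
  by apply/seteqP; split => y; rewrite /= in_itv.
have := gaussian_unique aXG YG mU.
rewrite (_ : (fun o => 0 + a^T *m X o) @^-1` _ = [set o | dotv a (X o) <= b]).
  move=> ->; congr (N01 _).
  have E (x : R) : (0 + a^T *m mu + s%:M *m x%:M) 0 0 = dotv a mu + s * x.
    by rewrite add0r -scalar_mxM mxE [X in _ + X]mxE eqxx mulr1n.
  by apply/seteqP; split => x /=; rewrite E.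
by apply/seteqP; split => o /=; rewrite add0r.
Qed.

(** The half-line up to the quantile has mass exactly [1 - p], so it is enough that the event
    contains it. *)
Lemma gaussian_chance d (T : measurableType d) (P : probability T R) n
    (X : T -> 'cV[R]_n) mu Sigma Sigma' (a : 'cV[R]_n) (b p : R) :
  gaussian P X mu Sigma -> 0 < p <= 2^-1 ->
  quadf Sigma a <= quadf Sigma' a ->
  dotv a mu <= b - Num.sqrt (quadf Sigma' a) * Phi_inv (1 - p) ->
  ((1 - p)%:E <= P [set o | dotv a (X o) <= b]%R)%E.
Proof.
move=> XG /andP[p0 p1] SS' amu.
rewrite (gaussian_dotv_le _ _ XG).
have q : 2^-1 <= 1 - p < 1 by apply/andP; split; lra.
rewrite -{1}(Phi_invK q) PhiE; apply: le_measure; rewrite ?inE//.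
  rewrite (_ : [set x | _] =
    (fun x => Num.sqrt (quadf Sigma a) * x + dotv a mu) @^-1` `]-oo, b]).
    by apply: measurable_preimage => //; exact: measurable_affine.
  by apply/seteqP; split => x; rewrite /= in_itv/= addrC.
move=> x /=; rewrite in_itv/= => xz.
have z0 := Phi_inv_ge0 q.
have h1 : Num.sqrt (quadf Sigma a) * x <= Num.sqrt (quadf Sigma a) * Phi_inv (1 - p).
  by rewrite ler_wpM2l// sqrtr_ge0.
(* Nonnegativity of the quantile is what makes the margin monotone in the covariance. *)
have h2 : Num.sqrt (quadf Sigma a) * Phi_inv (1 - p) <=
    Num.sqrt (quadf Sigma' a) * Phi_inv (1 - p).
  by rewrite ler_wpM2r// ler_wsqrtr.
lra.
Qed.

Lemma gaussian_chance_constraints d (T : measurableType d) (P : probability T R)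
    n m (c : chance_data R n m) (X : T -> 'cV[R]_n) mu Sigma Sigma' :
  gaussian P X mu Sigma -> (forall i, 0 < risk c i <= 2^-1) ->
  (forall v, quadf Sigma v <= quadf Sigma' v) -> tightened c Sigma' mu ->
  chance_constraints c P X.
Proof. by move=> XG p SS cmu i; exact: (gaussian_chance XG (p i) (SS _) (cmu i)). Qed.

End chance.

(** * Systems in the convex hull and the semidefinite program *)

Section polytopic.
Context {R : realType} {nx nu nw Np : nat}.
Variable vert : 'I_Np -> affine_system R nx nu nw.

(** The point is that the same weights serve all four blocks. *)
Lemma conv_hull_sys (s : affine_system R nx nu nw) :
  conv_hull (fun l => sys_mx (vert l)) (sys_mx s) ->
  exists lam : 'I_Np -> R, [/\ forall l, 0 <= lam l, \sum_l lam l = 1 &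
    [/\ sysA s = \sum_l lam l *: sysA (vert l),
        sysB s = \sum_l lam l *: sysB (vert l),
        sysD s = \sum_l lam l *: sysD (vert l) &
        sysr s = \sum_l lam l *: sysr (vert l)]].
Proof.
move=> [lam [lam0 lam1 sE]]; exists lam; split => //.
have projE p q (f : {linear 'M[R]_(nx, nx + nu + nw + 1) -> 'M[R]_(p, q)}) :
    f (sys_mx s) = \sum_l lam l *: f (sys_mx (vert l)).
  by rewrite sE linear_sum; apply: eq_bigr => l _; rewrite linearZ.
split.
- have := projE _ _ (lsubmx \o lsubmx \o lsubmx).
  rewrite /= /sys_mx !row_mxKl => ->.
  by apply: eq_bigr => l _; rewrite !row_mxKl.
- have := projE _ _ (rsubmx \o lsubmx \o lsubmx).
  rewrite /= /sys_mx !row_mxKl row_mxKr => ->.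
  by apply: eq_bigr => l _; rewrite !row_mxKl row_mxKr.
- have := projE _ _ (rsubmx \o lsubmx).
  rewrite /= /sys_mx !row_mxKl row_mxKr => ->.
  by apply: eq_bigr => l _; rewrite !row_mxKl row_mxKr.
- have := projE _ _ rsubmx.
  rewrite /= /sys_mx row_mxKr => ->.
  by apply: eq_bigr => l _; rewrite row_mxKr.
Qed.

(** A weighted variance is nonnegative. It is needed because [D D^T] is not affine in the system. *)
Lemma sqr_convex (I : finType) (lam f : I -> R) :
  (forall l, 0 <= lam l) -> \sum_l lam l = 1 ->
  (\sum_l lam l * f l) ^+ 2 <= \sum_l lam l * f l ^+ 2.
Proof.
move=> lam0 lam1; set m := \sum_l _.
have : 0 <= \sum_l lam l * (f l - m) ^+ 2.
  by apply: sumr_ge0 => l _; rewrite mulr_ge0// sqr_ge0.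
have -> : \sum_l lam l * (f l - m) ^+ 2 =
    \sum_l lam l * f l ^+ 2 - 2 * m * m + m ^+ 2 * \sum_l lam l.
  have -> : 2 * m * m = \sum_l 2 * m * (lam l * f l) by rewrite -mulr_sumr.
  rewrite [m ^+ 2 * _]mulr_sumr -sumrB -[RHS]big_split/=.
  by apply: eq_bigr => l _; ring.
by rewrite lam1; lra.
Qed.

(* Evaluating the block quadratic form at (y, - K^T y) is the Schur complement
   argument with the inverse of [S] already multiplied out. *)
Lemma sdp_invariant (s : affine_system R nx nu nw) (S Q : 'M[R]_nx)
    (Z : 'M[R]_(nu, nx)) :
  conv_hull (fun l => sys_mx (vert l)) (sys_mx s) ->
  sdp_feasible vert S Z -> pd S -> Q^T = Q -> loewner_le Q S ->
  let K := sysA s + sysB s *m (Z *m invmx S) in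
  loewner_le (K *m Q *m K^T + sysD s *m (sysD s)^T) S.
Proof.
move=> sco SZ [ST Spd] QT QS K; split.
  rewrite !linearB/= ST linearD/= !trmx_mul !trmxK QT -!mulmxA.
  by rewrite mulmxA.
have addE (M N : 'M[R]_1) : (M + N) 0 0 = M 0 0 + N 0 0 by rewrite mxE.
have oppE (M : 'M[R]_1) : (- M) 0 0 = - M 0 0 by rewrite mxE.
have trE (M : 'M[R]_1) : M^T 0 0 = M 0 0 by rewrite mxE.
move=> y; rewrite quadfB quadfD quadf_congr.
have [lam [lam0 lam1 [AE BE DE _]]] := conv_hull_sys sco.
have Sunit : S \in unitmx.
  rewrite -row_free_unit -kermx_eq0; apply/rowV0P => v /sub_kermxP vS.
  apply/eqP; apply: contraT => v0.
  have := Spd v^T; rewrite trmx_eq0 v0 /quadf trmxK vS mul0mx mxE ltxx.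
  by move=> /(_ isT).
(* [K] is the gain of the actual system, so [z] is the same for all vertices and the forms below can
   be averaged over [l]. *)
pose z := K^T *m y.
have KS : K *m S = sysA s *m S + sysB s *m Z.
  by rewrite mulmxDl -!mulmxA mulVmx// mulmx1.
(* The block form of vertex [l] evaluated at [(y, - z)]. *)
pose q l := quadf S y - quadf (sysD (vert l) *m (sysD (vert l))^T) y
  - 2 * (y^T *m (sysA (vert l) *m S + sysB (vert l) *m Z) *m z) 0 0 + quadf S z.
have q0 l : 0 <= q l.
  have [_ /(_ (col_mx y (- z)))] := SZ l.
  rewrite /quadf tr_col_mx mul_row_block mul_row_col.
  have -> : S *m (sysA (vert l))^T + Z^T *m (sysB (vert l))^T =
      (sysA (vert l) *m S + sysB (vert l) *m Z)^T.
    by rewrite linearD/= !trmx_mul ST.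
  rewrite /q; set V := sysA (vert l) *m S + _.
  rewrite linearN/= !mulmxDl !mulNmx !mulmxN opprK !addE !oppE.
  rewrite mulmxBr mulmxBl addE oppE.
  have -> : (z^T *m V^T *m y) 0 0 = (y^T *m V *m z) 0 0.
    by rewrite -[RHS]trE !trmx_mul !trmxK !mulmxA.
  rewrite /quadf; lra.
have : 0 <= \sum_l lam l * q l by apply: sumr_ge0 => l _; rewrite mulr_ge0.
have sumV : \sum_l lam l * (y^T *m (sysA (vert l) *m S + sysB (vert l) *m Z) *m z) 0 0
    = quadf S z.
  have -> : quadf S z = (y^T *m (K *m S) *m z) 0 0.
    by rewrite /quadf /z trmx_mul trmxK !mulmxA.
  rewrite KS AE BE mulmx_suml mulmx_suml -big_split/= mulmx_sumr mulmx_suml.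
  rewrite summxE; apply: eq_bigr => l _.
  by rewrite -!scalemxAl -scalerDr -scalemxAr -scalemxAl [RHS]mxE.
have sumD : quadf (sysD s *m (sysD s)^T) y <=
    \sum_l lam l * quadf (sysD (vert l) *m (sysD (vert l))^T) y.
  rewrite quadf_gram.
  under [in leRHS]eq_bigr do rewrite quadf_gram mulr_sumr.
  rewrite exchange_big/=; apply: ler_sum => k _.
  rewrite (_ : ((sysD s)^T *m y) k 0 =
    \sum_l lam l * ((sysD (vert l))^T *m y) k 0); first exact: sqr_convex.
  rewrite DE linear_sum/= mulmx_suml summxE; apply: eq_bigr => l _.
  by rewrite linearZ/= -scalemxAl [LHS]mxE.
have -> : \sum_l lam l * q l = quadf S y * \sum_l lam l
    - \sum_l lam l * quadf (sysD (vert l) *m (sysD (vert l))^T) y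
    - 2 * \sum_l lam l * (y^T *m (sysA (vert l) *m S + sysB (vert l) *m Z) *m z) 0 0
    + quadf S z * \sum_l lam l.
  rewrite [quadf S y * _]mulr_sumr [2 * _]mulr_sumr [quadf S z * _]mulr_sumr.
  rewrite -!sumrB -[RHS]big_split/=.
  by apply: eq_bigr => l _; rewrite /q; ring.
(* The cross term averages to [- 2 z^T S z]; with the last term it leaves [- z^T S z], which is at
   most [- z^T Q z]. *)
rewrite lam1 sumV; have := loewner_quadf z QS; lra.
Qed.

End polytopic.

(** * Convexity of the terminal set *)

Section terminal_set.
Context {R : realType} {nx nu nw Np : nat}.
Variable vert : 'I_Np -> affine_system R nx nu nw.

Definition convex_hull n (X : set 'cV[R]_n) : set 'cV[R]_n :=
  [set y | exists (m : nat) (p : 'I_m -> 'cV[R]_n),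
     (forall i, X (p i)) /\ conv_hull p y].

Lemma tightened_convex n m (c : chance_data R n m) (S : 'M[R]_n) k
    (lam : 'I_k -> R) (p : 'I_k -> 'cV[R]_n) :
  (forall i, 0 <= lam i) -> \sum_i lam i = 1 ->
  (forall i, tightened c S (p i)) -> tightened c S (\sum_i lam i *: p i).
Proof.
move=> lam0 lam1 pc j.
set b := _ - _.
have -> : dotv (alpha c j) (\sum_i lam i *: p i) = \sum_i lam i * dotv (alpha c j) (p i).
  rewrite /dotv mulmx_sumr summxE; apply: eq_bigr => i _.
  by rewrite -scalemxAr mxE.
rewrite -[leRHS]mul1r -lam1 mulr_suml; apply: ler_sum => i _.
by rewrite ler_wpM2l//; exact: pc.
Qed.

(* The convex hull of the terminal set is again invariant, so the largest
   invariant set is convex. *)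
Lemma terminal_step Nx Nu (cx : chance_data R nx Nx) (cu : chance_data R nu Nu)
    Sx Su X mu :
  largest_invariant_in vert (tightened cx Sx) (tightened cu Su) X -> X mu ->
  exists2 v, tightened cu Su v &
    forall s, conv_hull (fun l => sys_mx (vert l)) (sys_mx s) ->
      X (sysA s *m mu + sysB s *m v + sysr s).
Proof.
move=> [[XXs Xinv] Xmax] Xmu.
have hullX : convex_hull X `<=` X.
  apply: Xmax; split=> [_ [m [p [Xp [lam [lam0 lam1 ->]]]]]|].
    by apply: tightened_convex => // i; exact: XXs.
  move=> _ [m [p [Xp [lam [lam0 lam1 ->]]]]].
  (* A convex combination of points is controlled by the same combination of their controls. *)
  have /boolp.choice[v vP] : forall i, exists v, tightened cu Su v /\
      forall l, X (sysA (vert l) *m p i + sysB (vert l) *m v + sysr (vert l)).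
    by move=> i; have [v Uv Xv] := Xinv _ (Xp i); exists v.
  exists (\sum_i lam i *: v i).
    by apply: tightened_convex => // i; have [] := vP i.
  move=> l; exists m, (fun i => sysA (vert l) *m p i + sysB (vert l) *m v i + sysr (vert l)).
  split; first by move=> i; have [_] := vP i; exact.
  exists lam; split => //.
  (* The offset is written as a combination of copies of itself, the weights summing to 1. *)
  rewrite -[sysr (vert l) in LHS]scale1r -lam1 scaler_suml !mulmx_sumr -!big_split/=.
  by apply: eq_bigr => i _; rewrite -!scalemxAr !scalerDr.
have [v Uv Xv] := Xinv _ Xmu.
exists v => // s /conv_hull_sys[lam [lam0 lam1 [-> -> _ ->]]].
(* The successor under [s] combines the vertex successors with the weights of [s]; a common control
   [v] for all vertices makes this possible. *)
apply: hullX; exists Np, (fun l => sysA (vert l) *m mu + sysB (vert l) *m v + sysr (vert l)).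
split => //; exists lam; split => //.
rewrite !mulmx_suml -!big_split/=.
by apply: eq_bigr => i _; rewrite -!scalemxAl !scalerDr.
Qed.

End terminal_set.

(** * Mean and covariance after one step *)

Section outer_moments.
Context {R : realType} d (T : measurableType d) (P : probability T R).

Definition outer m n (a : T -> 'cV[R]_m) (b : T -> 'cV[R]_n) : 'M[R]_(m, n) :=
  mean_mx P (fun o => a o *m (b o)^T).

Lemma outerDl m n (a a' : T -> 'cV[R]_m) (b : T -> 'cV[R]_n) :
  sq_integrable_mx P a -> sq_integrable_mx P a' -> sq_integrable_mx P b ->
  outer (fun o => a o + a' o) b = outer a b + outer a' b.
Proof.
move=> Ia Ia' Ib; rewrite /outer -mean_mxD; try exact: integrable_mx_outer.
by congr mean_mx; apply/funext => o; rewrite mulmxDl.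
Qed.

Lemma outer_tr m n (a : T -> 'cV[R]_m) (b : T -> 'cV[R]_n) :
  outer a b = (outer b a)^T.
Proof.
rewrite /outer -mean_mx_tr; congr mean_mx; apply/funext => o.
by rewrite trmx_mul trmxK.
Qed.

Lemma outerDr m n (a : T -> 'cV[R]_m) (b b' : T -> 'cV[R]_n) :
  sq_integrable_mx P a -> sq_integrable_mx P b -> sq_integrable_mx P b' ->
  outer a (fun o => b o + b' o) = outer a b + outer a b'.
Proof.
move=> Ia Ib Ib'; rewrite outer_tr outerDl// linearD/=.
by rewrite -!outer_tr.
Qed.

Lemma outer_mull m p n (A : 'M[R]_(p, m)) (a : T -> 'cV[R]_m) (b : T -> 'cV[R]_n) :
  sq_integrable_mx P a -> sq_integrable_mx P b ->
  outer (fun o => A *m a o) b = A *m outer a b.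
Proof.
move=> Ia Ib; rewrite /outer -mean_mx_mull; last exact: integrable_mx_outer.
by congr mean_mx; apply/funext => o; rewrite mulmxA.
Qed.

Lemma outer_mulr m p n (A : 'M[R]_(p, n)) (a : T -> 'cV[R]_m) (b : T -> 'cV[R]_n) :
  sq_integrable_mx P a -> sq_integrable_mx P b ->
  outer a (fun o => A *m b o) = outer a b *m A^T.
Proof.
by move=> Ia Ib; rewrite outer_tr outer_mull// trmx_mul -outer_tr.
Qed.

Lemma gaussian_sym n (w : T -> 'cV[R]_n) Q :
  gaussian P w 0 Q -> same_law P P w (fun o => - w o).
Proof.
move=> wG; apply: (gaussian_unique wG).
have := gaussian_affine (- 1%:M) 0 wG.
rewrite mulmx0 addr0 linearN/= trmx1 mulNmx mulmxN mul1mx mulmx1 opprK.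
by under eq_fun do rewrite add0r mulNmx mul1mx.
Qed.

Lemma outer_indep0 m n d' (S : measurableType d') (X : T -> S)
    (f : S -> 'cV[R]_m) (w : T -> 'cV[R]_n) :
  measurable_fun setT X -> measurable_fun setT f -> measurable_fun setT w ->
  indep_pair P X w -> same_law P P w (fun o => - w o) ->
  sq_integrable_mx P (fun o => f (X o)) -> sq_integrable_mx P w ->
  outer (fun o => f (X o)) w = 0.
Proof.
move=> mX mf mw Xw sw If Iw; apply/matrixP => i j; rewrite mean_mxE [RHS]mxE.
under eq_fun do rewrite mxE big_ord1 mxE.
have me : measurable_fun setT (fun y : 'cV[R]_n => y j 0) by exact: measurable_mx_entry.
apply: (indep_symmetric_expectation (f := fun y => f y i 0) (w := fun o => w o j 0) mX).
- exact: measurable_entry.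
- exact: measurable_entry.
- exact: (indep_pair_comp (@measurable_id _ _ setT) me Xw).
- have := same_law_comp me sw.
  by under [X in same_law _ _ _ X -> _]eq_fun do rewrite mxE.
- exact: sq_integrable_mul.
Qed.

End outer_moments.

Section step_moments.
Context {R : realType} {nx nu nw : nat} (s : affine_system R nx nu nw).
Context d (T : measurableType d) (P : probability T R).
Variables (x : T -> 'cV[R]_nx) (w : T -> 'cV[R]_nw) (f : 'cV[R]_nx -> 'cV[R]_nu).
Variables (mu : 'cV[R]_nx) (Sigma : 'M[R]_nx).
Hypotheses (mx : measurable_fun setT x) (mw : measurable_fun setT w)
  (mf : measurable_fun setT f).
Hypotheses (xG : gaussian P x mu Sigma) (wG : gaussian P w 0 1%:M)
  (xw : indep_pair P x w) (fS : square_integrable P (fun o => f (x o))).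

Let u o := f (x o).
Let ubar := mean_mx P u.
Let dx o := x o - mu.
Let du o := u o - ubar.

Let mu_x : mean_mx P x = mu. Proof. exact: gaussian_mean xG. Qed.
Let Ix : sq_integrable_mx P x. Proof. exact: gaussian_sq_integrable xG. Qed.
Let Iw : sq_integrable_mx P w. Proof. exact: gaussian_sq_integrable wG. Qed.
Let Iu : sq_integrable_mx P u.
Proof. by apply/square_integrableP => //; exact: (measurableT_comp mf mx). Qed.
Let Idx : sq_integrable_mx P dx.
Proof. by apply: sq_integrable_mxD => //; exact: sq_integrable_mx_cst. Qed.
Let Idu : sq_integrable_mx P du.
Proof. by apply: sq_integrable_mxD => //; exact: sq_integrable_mx_cst. Qed.

Let xnew o := step s (x o) (u o) (w o).

Lemma step_mean :
  mean_mx P xnew = sysA s *m mu + sysB s *m ubar + sysr s.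
Proof.
rewrite /xnew /step.
have IA : integrable_mx P (fun o => sysA s *m x o).
  exact/integrable_mx_mull/sq_integrable_mx_integrable.
have IB : integrable_mx P (fun o => sysB s *m u o).
  exact/integrable_mx_mull/sq_integrable_mx_integrable.
have ID : integrable_mx P (fun o => sysD s *m w o).
  exact/integrable_mx_mull/sq_integrable_mx_integrable.
have IAB := integrable_mxD IA IB.
rewrite mean_mxD; [|exact: (integrable_mxD IAB ID)|exact: integrable_mx_cst].
rewrite (mean_mxD IAB ID) (mean_mxD IA IB) mean_mx_cst.
rewrite !mean_mx_mull; try exact: sq_integrable_mx_integrable.
by rewrite mu_x (gaussian_mean mw wG) mulmx0 addr0.
Qed.

(** The deviation is [A dx + B du + D w]. Products of [w] with functions of [x] average to 0; the
    moments of [x] with [u] stay, [u] being an arbitrary function of [x]. *)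
Lemma step_cov :
  cov_mx P xnew =
  sysA s *m Sigma *m (sysA s)^T + sysA s *m outer P dx du *m (sysB s)^T
  + sysB s *m (outer P dx du)^T *m (sysA s)^T
  + sysB s *m outer P du du *m (sysB s)^T + sysD s *m (sysD s)^T.
Proof.
rewrite /cov_mx step_mean.
pose p o := sysA s *m dx o; pose q o := sysB s *m du o; pose e o := sysD s *m w o.
have Ip : sq_integrable_mx P p by exact: sq_integrable_mx_mull.
have Iq : sq_integrable_mx P q by exact: sq_integrable_mx_mull.
have Ie : sq_integrable_mx P e by exact: sq_integrable_mx_mull.
pose y o := p o + q o + e o.
transitivity (outer P y y).
  congr mean_mx; apply/funext => o.
  suff -> : xnew o - (sysA s *m mu + sysB s *m ubar + sysr s) = y o by [].
  rewrite /xnew /step /y /p /q /e /dx /du !mulmxBr.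
  have alg (a b c r a' b' : 'cV[R]_nx) :
      a + b + c + r - (a' + b' + r) = a - a' + (b - b') + c.
    by apply/colP => i; rewrite !mxE; ring.
  exact: alg.
have Ipq : sq_integrable_mx P (fun o => p o + q o) by exact: sq_integrable_mxD.
have Iy : sq_integrable_mx P y by exact: sq_integrable_mxD.
have sw := gaussian_sym wG.
have dxw : outer P dx w = 0.
  have mc : measurable_fun setT (fun y : 'cV[R]_nx => y - mu).
    exact: measurable_addmx.
  exact: (outer_indep0 mx mc mw xw sw Idx Iw).
have duw : outer P du w = 0.
  have mc : measurable_fun setT (fun y : 'cV[R]_nx => f y - ubar).
    exact: measurable_addmx.
  exact: (outer_indep0 mx mc mw xw sw Idu Iw).
have ww : outer P w w = 1%:M.
  have := gaussian_cov mw wG; rewrite /cov_mx (gaussian_mean mw wG).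
  by under eq_fun do rewrite subr0.
have xx : outer P dx dx = Sigma.
  by have := gaussian_cov mx xG; rewrite /cov_mx mu_x.
rewrite (outerDl Ipq Ie Iy) (outerDl Ip Iq Iy).
rewrite !(outerDr _ Ipq Ie)// !(outerDr _ Ip Iq)//.
rewrite /p /q /e !outer_mull// !outer_mulr//.
rewrite dxw duw ww xx (outer_tr P w dx) (outer_tr P w du) dxw duw.
rewrite (outer_tr P du dx) !trmx0 !mul0mx !mulmx0 mul1mx !addr0 !add0r.
by rewrite !mulmxA !addrA.
Qed.

End step_moments.

(** * Recursive feasibility and the closed loop *)

Section recursion.
Context {R : realType} {nx nu nw Np Nx Nu : nat} (pb : ocp R nx nu nw Nx Nu).
Variables (vert : 'I_Np -> affine_system R nx nu nw) (Z : 'M[R]_(nu, nx)).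

Lemma measurable_step2 (s : affine_system R nx nu nw)
    (f : {mfun 'cV[R]_nx >-> 'cV[R]_nu}) :
  measurable_fun setT (fun z : 'cV[R]_nx * 'cV[R]_nw => step s z.1 (f z.1) z.2).
Proof.
by apply: measurable_step => //; exact: (measurableT_comp (measurable_funPT f)).
Qed.

(** [admissible] gives Gaussianity with some parameters; computing the two moments identifies
    them. *)
Lemma propagated_gaussian k mu Sigma rho mu' Sigma' d (T : measurableType d)
    (P : probability T R) (w : nat -> {RV P >-> 'cV[R]_nw})
    (x : nat -> {RV P >-> 'cV[R]_nx}) :
  (0 < horizon pb)%N -> prediction pb k mu Sigma rho w x ->
  admissible pb k rho x -> propagated pb k mu Sigma rho mu' Sigma' ->
  gaussian P (x k.+1) mu' Sigma'.
Proof.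
move=> N0 [xG [wG _] xw xS] [aG aS] prop.
have [muE SigmaE] := prop _ _ P (x k) xG.
have kt : (k <= k < k + horizon pb)%N by rewrite leqnn -[X in (X < _)%N]addn0 ltn_add2l.
have mx := measurable_funPT (x k); have mw := measurable_funPT (w k).
have mf := measurable_funPT (rho k).
have xwk : indep_pair P (x k) (w k).
  exact: (stream_indep_pair (X := x k) (W := fun t => w t) xw).
have [m [S x1G]] : exists m S, gaussian P (x k.+1) m S.
  by apply: aG; rewrite leqnSn -addn1 leq_add2l.
have xE : (x k.+1 : T -> _) = fun o => step (dyn pb k) (x k o) (rho k (x k o)) (w k o).
  by apply/funext => o; exact: xS.
have mE : m = mu'.
  rewrite -(gaussian_mean (measurable_funPT (x k.+1)) x1G) xE muE.
  exact: (step_mean (dyn pb k) mx mw mf xG (wG k) (aS _ kt)).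
have SE : S = Sigma'.
  rewrite -(gaussian_cov (measurable_funPT (x k.+1)) x1G) xE SigmaE.
  exact: (step_cov (dyn pb k) mx mw mf xG (wG k) xwk (aS _ kt)).
by rewrite -mE -SE.
Qed.

(** At [j = horizon pb] it covers the disturbance of the appended stage; at [j = 1] it restarts the
    prediction at [k.+1]. *)
Lemma prediction_indep k mu Sigma rho d (T : measurableType d)
    (P : probability T R) (w : nat -> {RV P >-> 'cV[R]_nw})
    (x : nat -> {RV P >-> 'cV[R]_nx}) :
  prediction pb k mu Sigma rho w x ->
  forall j, (j <= horizon pb)%N -> stream_indep P (x (k + j)%N) w (k + j).
Proof.
move=> [_ _ xw xS]; elim=> [_|j IHj jN]; first by rewrite addn0.
have mstep := measurable_step2 (dyn pb (k + j)) (rho (k + j)%N).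
rewrite addnS; apply: (stream_indep_step _ _ mstep _ (IHj (ltnW jN))) => //.
by move=> o; rewrite xS// leq_addr ltn_add2l.
Qed.

Hypotheses (N0 : (0 < horizon pb)%N)
  (xrisk : forall i, 0 < risk (xcon pb) i <= 2^-1)
  (urisk : forall j, 0 < risk (ucon pb) j <= 2^-1)
  (hull : forall k, conv_hull (fun l => sys_mx (vert l)) (sys_mx (dyn pb k)))
  (sdp : sdp_solution vert (termSigma pb) Z) (Spd : pd (termSigma pb)).
Let L := Z *m invmx (termSigma pb).
Hypothesis termP : largest_invariant_in vert
     (tightened (xcon pb) (termSigma pb))
     (tightened (ucon pb) (L *m termSigma pb *m L^T))
     (termX pb).

(* The tail of a feasible policy is completed by the
   terminal controller [v + L (x - m)], [m] the mean of the last state. *)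
Lemma recursive_feasibility k mu Sigma rho c mu' Sigma' :
  feasible_with_cost pb k mu Sigma rho c ->
  propagated pb k mu Sigma rho mu' Sigma' ->
  feasible pb k.+1 mu' Sigma'.
Proof.
move=> [d [T [P [w [x [pred adm [cx cu tX tS] _]]]]]] prop.
set N := horizon pb in cx cu tX tS adm *.
have x1G := propagated_gaussian N0 pred adm prop.
have [xG [wG wI] xw xS] := pred; have [aG aS] := adm.
pose kN := (k + N)%N.
have mx := measurable_funPT (x kN); have mw := measurable_funPT (w kN).
have [m [S xkG]] : exists m S, gaussian P (x kN) m S.
  by apply: aG; rewrite leqnn leq_addr.
have mE := gaussian_mean mx xkG; have SE := gaussian_cov mx xkG.
rewrite -/kN mE in tX; rewrite -/kN SE in tS.
have [v Uv Xv] := terminal_step termP tX.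
have ctrl_m : measurable_fun setT (fun y : 'cV[R]_nx => v + L *m (y - m)).
  by apply: measurable_affine_rv; exact: measurable_addmx.
pose ctrl : {mfun 'cV[R]_nx >-> 'cV[R]_nu} := mfun_of ctrl_m.
(* Policies are indexed by absolute time, so the tail needs no shift and only the entry at [k + N]
   changes. *)
pose rho' t := if t == kN then ctrl else rho t.
have mnew : measurable_fun setT (fun o => step (dyn pb kN) (x kN o) (ctrl (x kN o)) (w kN o)).
  by apply: measurable_step => //; exact: (measurableT_comp ctrl_m).
pose xnew : {RV P >-> 'cV[R]_nx} := mfun_of mnew.
pose x' t : {RV P >-> 'cV[R]_nx} := if t == kN.+1 then xnew else x t.
have x'E t : (t <= kN)%N -> x' t = x t by move=> tk; rewrite /x' ltn_eqF.
have rho'E t : (t < kN)%N -> rho' t = rho t by move=> tk; rewrite /rho' ltn_eqF.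
have x'N : x' kN.+1 = xnew by rewrite /x' eqxx.
have rho'N : rho' kN = ctrl by rewrite /rho' eqxx.
have k1N : (k.+1 <= kN)%N by rewrite /kN -addn1 leq_add2l.
have kNS : (k.+1 + N = kN.+1)%N by [].
have uE : (fun o => ctrl (x kN o)) = fun o => (v - L *m m) + L *m x kN o.
  by apply/funext => o; rewrite /= mulmxBr addrA addrAC.
have uG : gaussian P (fun o => ctrl (x kN o)) v (L *m S *m L^T).
  by rewrite uE; have := gaussian_affine L (v - L *m m) xkG; rewrite addrNK.
have mu_ : measurable_fun setT (fun o => ctrl (x kN o)).
  exact: (measurableT_comp ctrl_m).
pose K := sysA (dyn pb kN) + sysB (dyn pb kN) *m L.
pose D := sysD (dyn pb kN).
pose b := sysB (dyn pb kN) *m (v - L *m m) + sysr (dyn pb kN).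
(* Under the affine terminal control the new state is an affine image of the last state plus an
   independent Gaussian term. *)
have xnewG : gaussian P xnew
    (sysA (dyn pb kN) *m m + sysB (dyn pb kN) *m v + sysr (dyn pb kN))
    (K *m S *m K^T + D *m D^T).
  have XG := gaussian_affine K b xkG.
  have WG := gaussian_affine D 0 (wG kN).
  have XW : indep_pair P (fun o => b + K *m x kN o) (fun o => 0 + D *m w kN o).
    have I := stream_indep_pair (prediction_indep pred (leqnn _)).
    have mK := measurable_affine_rv K b (@measurable_id _ 'cV[R]_nx setT).
    have mD := measurable_affine_rv D 0 (@measurable_id _ 'cV[R]_nw setT).
    exact: (indep_pair_comp mK mD I).
  have := gaussian_add (measurable_affine_rv K b mx) (measurable_affine_rv D 0 mw) XW XG WG.
  rewrite mulmx0 mulmx1 !addr0.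
  have -> : b + K *m m =
      sysA (dyn pb kN) *m m + sysB (dyn pb kN) *m v + sysr (dyn pb kN).
    rewrite /b /K mulmxBr mulmxDl mulmxA.
    have alg (p q g r : 'cV[R]_nx) : q - g + r + (p + g) = p + q + r.
      by apply/colP => i; rewrite !mxE; ring.
    exact: alg.
  suff -> : (fun o => b + K *m x kN o + (0 + D *m w kN o)) = xnew by [].
  apply/funext => o; rewrite add0r /= /step -/D.
  rewrite /b /K !mulmxDr !mulmxN mulmxDl !mulmxA.
  have alg (p q e r f g : 'cV[R]_nx) :
      q - g + r + (p + f) + e = p + (q + (f - g)) + e + r.
    by apply/colP => i; rewrite !mxE; ring.
  exact: alg.
(* The realization is kept: [w] is an infinite sequence, so the disturbance of the appended stage is
   already available. *)
exists rho', (expected_cost pb k.+1 rho' x'), d, T, P, w, x'.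
split => //.
- split.
  + by rewrite x'E.
  + by split.
  + rewrite x'E//; have := prediction_indep pred N0; rewrite addn1; exact.
  + move=> t /andP[kt]; rewrite kNS ltnS leq_eqVlt => /orP[/eqP->|tk] o.
      by rewrite x'N rho'N x'E.
    rewrite (x'E _ (ltnW tk)) (x'E t.+1)// rho'E//; apply: xS.
    by rewrite (ltnW kt).
- split=> t /andP[kt]; rewrite kNS.
    rewrite leq_eqVlt => /orP[/eqP->|]; first by rewrite x'N; do 2 eexists; exact: xnewG.
    by rewrite ltnS => tk; rewrite x'E//; apply: aG; rewrite (ltnW kt).
  rewrite ltnS leq_eqVlt => /orP[/eqP->|tk].
    rewrite rho'N x'E//; apply/square_integrableP => //.
    exact: gaussian_sq_integrable uG.
  by rewrite rho'E// (x'E _ (ltnW tk)); apply: aS; rewrite (ltnW kt).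
- split.
  + move=> t /andP[kt]; rewrite kNS ltnS leq_eqVlt => /orP[/eqP->|tk].
      (* Time [k + N] carried only terminal constraints so far; they imply the chance constraints
         there. *)
      rewrite x'E//; apply: (gaussian_chance_constraints xkG xrisk).
        by move=> y; exact: loewner_quadf tS.
      by have [[XXs _] _] := termP; exact: XXs.
    by rewrite (x'E _ (ltnW tk)); apply: cx; rewrite (ltnW kt).
  + move=> t /andP[kt]; rewrite kNS ltnS leq_eqVlt => /orP[/eqP->|tk].
      rewrite x'E// rho'N; apply: (gaussian_chance_constraints uG urisk _ Uv).
      by move=> y; rewrite !quadf_congr; exact: loewner_quadf tS.
    by rewrite (x'E _ (ltnW tk)) rho'E//; apply: cu; rewrite (ltnW kt).
  + rewrite kNS x'N (gaussian_mean (measurable_funPT xnew) xnewG).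
    exact: Xv (hull kN).
  + rewrite kNS x'N (gaussian_cov (measurable_funPT xnew) xnewG).
    apply: (sdp_invariant (hull kN) sdp.1 Spd _ tS).
    (* [S] is symmetric, being a covariance. *)
    by rewrite -SE /cov_mx -mean_mx_tr; congr mean_mx; apply/funext => o;
      rewrite trmx_mul trmxK.
Qed.

End recursion.

(** * Transfer of the constraints to the closed loop *)

Theorem theorem3 (R : realType) (nx nu nw Np Nx Nu : nat)
    (pb : ocp R nx nu nw Nx Nu)
    (vert : 'I_Np -> affine_system R nx nu nw)
    (Z : 'M[R]_(nu, nx))
    (d : measure_display) (T : measurableType d) (P : probability T R)
    (w : nat -> {RV P >-> 'cV[R]_nw})
    (x0 : 'cV[R]_nx) (x : nat -> T -> 'cV[R]_nx)
    (mu : nat -> 'cV[R]_nx) (Sigma : nat -> 'M[R]_nx)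
    (rho : nat -> policies R nx nu) :
  (0 < horizon pb)%N ->
  (forall i, 0 < risk (xcon pb) i <= 2^-1) ->
  (forall j, 0 < risk (ucon pb) j <= 2^-1) ->
  (forall k, conv_hull (fun l => sys_mx (vert l)) (sys_mx (dyn pb k))) ->
  (forall k, psd (costQ pb k)) ->
  (forall k, pd (costR pb k)) ->
  (exists M : R, forall k, (forall i j, `|costQ pb k i j| <= M) /\
                           (forall i j, `|costR pb k i j| <= M)) ->
  (forall k, polyhedron (xcon pb) (xgoal pb k)) ->
  sdp_solution vert (termSigma pb) Z ->
  pd (termSigma pb) ->
  (let L := Z *m invmx (termSigma pb) in
   largest_invariant_in vert
     (tightened (xcon pb) (termSigma pb))
     (tightened (ucon pb) (L *m termSigma pb *m L^T))
     (termX pb)) ->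
  (* the closed loop, started at x0 *)
  iid_standard_normal P w ->
  (forall o, x 0%N o = x0) ->
  (forall k o, x k.+1 o = step (dyn pb k) (x k o) (rho k k (x k o)) (w k o)) ->
  (* rho k t is the optimal policy for time t computed at time k *)
  (forall k, feasible pb k (mu k) (Sigma k) ->
     optimal pb k (mu k) (Sigma k) (rho k)) ->
  mu 0%N = x0 -> Sigma 0%N = 0 ->
  (forall k, propagated pb k (mu k) (Sigma k) (rho k) (mu k.+1) (Sigma k.+1)) ->
  feasible pb 0 x0 0 ->
  forall k, chance_constraints (xcon pb) P (x k) /\
            chance_constraints (ucon pb) P (fun o => rho k k (x k o)).

Proof.
move=> N0 xrisk urisk hull _ _ _ _ sdp Spd /= termP [wG wI] x0E xS opt mu0 Sigma0 prop feas.
have wiid : iid_standard_normal P w by [].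
have main k : [/\ measurable_fun setT (x k), stream_indep P (x k) w k,
    gaussian P (x k) (mu k) (Sigma k) & feasible pb k (mu k) (Sigma k)].
  elim: k => [|k [mx xw xG kfeas]].
    rewrite mu0 Sigma0; split => //.
    - by rewrite (_ : x 0%N = cst x0)//; apply/funext => o; exact: x0E.
    - exact: stream_indep_cst x0E wI.
    - exact: gaussian_cst.
  have [c copt _] := opt k kfeas.
  have kfeas' := recursive_feasibility N0 xrisk urisk hull sdp Spd termP copt (prop k).
  (* The primed objects realize the optimal plan on a space of their own. *)
  have [d' [T' [P' [w' [x' [pred adm _ _]]]]]] := copt.
  have x1G := propagated_gaussian N0 pred adm (prop k).
  have [xG' [wG' _] xw' xS'] := pred.
  have mf := measurable_step2 (dyn pb k) (rho k k).
  have mw t := measurable_funPT (w t); have mw' t := measurable_funPT (w' t).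
  have xw1 : (x k.+1 : T -> _) = fun o => step (dyn pb k) (x k o) (rho k k (x k o)) (w k o).
    by apply/funext => o; exact: xS.
  have mx1 : measurable_fun setT (x k.+1).
    by rewrite xw1; exact: (measurableT_comp mf (measurable_fun_pair mx (mw k))).
  split => //.
    exact: (stream_indep_step mx mw mf (xS k) xw).
  apply: gaussian_law x1G _.
  (* State and disturbance are independent on both sides and have equal laws, so the pairs have
     equal laws; applying the common step map gives the successors. *)
  have := same_law_pair (measurable_funPT (x' k)) (mw' k) mx (mw k)
    (stream_indep_pair (X := x' k) (W := fun t => w' t) xw') (stream_indep_pair xw)
    (gaussian_unique xG' xG)
    (gaussian_unique (wG' k) (wG k)).
  move=> /(same_law_comp mf); rewrite /= -xw1.
  suff <- : (x' k.+1 : T' -> _) = fun o => step (dyn pb k) (x' k o) (rho k k (x' k o)) (w' k o) by [].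
  apply/funext => o; apply: xS'.
  by rewrite leqnn -[X in (X < _)%N]addn0 ltn_add2l.
move=> k; have [mx xw xG kfeas] := main k.
have [c [d' [T' [P' [w' [x' [[xG' _ _ _] _ [cx cu _ _] _]]]]]] _] := opt k kfeas.
have kt : (k <= k < k + horizon pb)%N by rewrite leqnn -[X in (X < _)%N]addn0 ltn_add2l.
have xx' := gaussian_unique xG xG'.
(* Used with the identity for the state and with [rho k k] for the control. *)
have chance n m (cc : chance_data R n m) (f : 'cV[R]_nx -> 'cV[R]_n) :
    measurable_fun setT f -> chance_constraints cc P' (fun o => f (x' k o)) ->
    chance_constraints cc P (fun o => f (x k o)).
  move=> mf H i; apply: le_trans (H i) _.
  have mU : measurable [set y | dotv (alpha cc i) (f y) <= beta cc i].
    rewrite (_ : [set y | _] = (fun y => dotv (alpha cc i) (f y)) @^-1` `]-oo, beta cc i]).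
      by apply: measurable_preimage => //; exact: measurable_dotv.
    by apply/seteqP; split => y; rewrite /= in_itv.
  by rewrite -(xx' _ mU).
split; first exact: (chance _ _ _ id (@measurable_id _ _ setT) (cx _ kt)).
exact: (chance _ _ _ _ (measurable_funPT (rho k k)) (cu _ kt)).
Qed.
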